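(* Let $G$ be a graph on $n \ge 7$ vertices with $e(G) \ge \binom{n}{2} - (n - 4)$ edges. Then there is a fractional triangle decomposition in $G$.
   Context: Graphs are finite and simple; $e(G)$ is the number of edges of $G$. A fractional triangle packing in a graph $G$ is an assignment $\omega$ of weights in $[0,1]$ to the triangles of $G$ such that $\sum_{w \in V(G)} \omega(uvw) \le 1$ for every edge $uv$ of $G$, where $\omega(uvw) = 0$ if $uvw$ is not a triangle in $G$. For an edge $e = uv$ of $G$ write $\omega(e) = \sum_{w \in V(G)} \omega(uvw)$. A fractional triangle decomposition in $G$ is a fractional triangle packing $\omega$ in $G$ with $\omega(e) = 1$ for every edge $e$ of $G$. *)

(* Defs.v *)
From mathcomp Require Import all_boot all_order all_algebra.
From mathcomp Require Import reals.

Set Implicit Arguments.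
Unset Strict Implicit.
Unset Printing Implicit Defensive.

Import Order.TTheory GRing.Theory Num.Theory.

Record sgraph (T : finType) := SGraph {
  adj :> rel T;
  adj_sym : symmetric adj;
  adj_irr : irreflexive adj }.

Section Triangles.
Variables (T : finType) (G : sgraph T).

Definition edges : {set {set T}} :=
  [set A | [exists u, exists v, G u v && (A == [set u; v])]].

Definition triangles : {set {set T}} :=
  [set A | [exists u, exists v, exists w,
    [&& G u v, G v w, G u w & A == [set u; v; w]]]].

Local Open Scope ring_scope.
Variable R : realType.

(* If x is u or v, then [set u; v; x] = [set u; v] is not a triangle, so such x
   contribute 0 as soon as omega vanishes outside the triangles. *)
Definition edge_weight (omega : {set T} -> R) (u v : T) : R :=
  \sum_(x : T) omega [set u; v; x].

Definition fractional_triangle_packing (omega : {set T} -> R) : Prop :=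
  [/\ forall A, A \in triangles -> 0 <= omega A <= 1,
      forall A, A \notin triangles -> omega A = 0
    & forall u v, G u v -> edge_weight omega u v <= 1].

Definition fractional_triangle_decomposition (omega : {set T} -> R) : Prop :=
  fractional_triangle_packing omega /\
  forall u v, G u v -> edge_weight omega u v = 1.

End Triangles.

(* Main.v *)
Require Import Defs.
From mathcomp Require Import all_boot all_order all_algebra.
From mathcomp Require Import reals.
From mathcomp Require Import ring lra zify.

(** Call a demand on pairs of vertices decomposable when it is the sum of
    nonnegatively weighted triangles, exactly on every pair.  Decomposable
    demands form a convex cone, and the proof is an induction on the vertex set
    [A] inside this cone.  With [n = #|A|], at most [n - 4] pairs are missing;
    [h] is the graph of missing pairs and all degrees below are degrees in [h].

    Deleting a vertex [u] costs one unit of the allowance [n - 4] and frees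
    [degree u] missing pairs.  If all deletions stay within the allowance, the
    decompositions of the graphs [A :\ u] add up to [n - 2] times the graph on
    [A] ([decomposable_average]).  This fails only if exactly [n - 4] pairs are
    missing and the set [I] of vertices of degree 0 is not empty.  Let
    [J = A :\: I]; only the vertices of [J] may be deleted.  Deleting each of
    them once covers a pair inside [J] [#|J| - 2] times, but a pair between [I]
    and [J] once more and a pair inside [I] twice more.  The excess is removed
    with the slack [degree u - 1] left over by the deletion of [u]: one unit
    pays for deleting a vertex of [I] together with [u], or for dropping one
    more pair from the demand.

    - A vertex [c] with [3 * degree c > n] is split off at once: its link in the
      graph has a fractional perfect matching [f], the triangles through [c]
      get the weights [f], and the slack of [c] pays for subtracting [f] from
      the demand on the remaining vertices ([decomposable_hub]).
    - If [#|I| <= 2], the slack is spent integrally ([decomposable_assignment]).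
    - If [#|I| >= 3], only the total coverage between each vertex of [J] and
      [I], and inside [I], has to be right, since pairs that are covered too
      little can be topped up by triangles with two or three vertices in [I]
      ([decomposable_balance]).  When [#|I| >= #|J| - 2] such triangles, and
      those with one vertex in [I], are already enough
      ([decomposable_many_isolated]).  Otherwise the deletion of [u] is combined
      with that of [minn #|I| (degree u - 1)] vertices of [I]
      ([decomposable_full_deletion]); when this removes too few vertices of [I],
      some vertex has more slack than there are vertices in [I], and its excess
      slack goes into lowering pairs between [I] and [J]
      ([decomposable_dominant_hub]).

    The slack is spent fractionally in places.  This is harmless, because the
    allowance is an integer: a fractional set of missing pairs within it is a
    convex combination of graphs within it ([hull_ind]).  The induction starts
    with [7 <= n <= 9], where weights are given for every graph of missing pairs
    up to isomorphism ([decomposable_catalogued]). *)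

Set Implicit Arguments.
Unset Strict Implicit.
Unset Printing Implicit Defensive.
Import Order.TTheory GRing.Theory Num.Theory.
Local Open Scope ring_scope.

(** * Decomposable demands *)
Section Decomposable.
Variables (R : realFieldType) (T : finType).
Implicit Types (d p : T -> T -> R) (A I J : {set T}).

(** The weight of a triangle is a symmetric function of its three corners, and
    the diagonal of a demand carries no information. *)
Definition decomposable d : Prop := exists w : T -> T -> T -> R,
  [/\ forall x y z, 0 <= w x y z,
      forall x y z, w x y z = w y x z,
      forall x y z, w x y z = w x z y,
      forall x y, w x x y = 0
    & forall x y, x != y -> \sum_z w x y z = d x y].

Lemma decomposable_ext d d' :
  (forall x y, x != y -> d x y = d' x y) -> decomposable d -> decomposable d'.
Proof.
move=> dd' [w [w0 w1 w2 wd ws]]; exists w; split=> // x y xy.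
by rewrite ws // dd'.
Qed.

Lemma decomposable0 : decomposable (fun _ _ => 0).
Proof. by exists (fun _ _ _ => 0); split=> // x y _; rewrite big1. Qed.

Lemma decomposableD d d' : decomposable d -> decomposable d' ->
  decomposable (fun x y => d x y + d' x y).
Proof.
move=> [w [w0 w1 w2 wd ws]] [v [v0 v1 v2 vd vs]].
exists (fun x y z => w x y z + v x y z); split=> [x y z|x y z|x y z|x y|x y xy].
- by rewrite addr_ge0.
- by rewrite w1 v1.
- by rewrite w2 v2.
- by rewrite wd vd addr0.
- by rewrite big_split /= ws // vs.
Qed.

Lemma decomposableZ a d : 0 <= a -> decomposable d ->
  decomposable (fun x y => a * d x y).
Proof.
move=> a0 [w [w0 w1 w2 wd ws]].
exists (fun x y z => a * w x y z); split=> [x y z|x y z|x y z|x y|x y xy].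
- by rewrite mulr_ge0.
- by rewrite w1.
- by rewrite w2.
- by rewrite wd mulr0.
- by rewrite -mulr_sumr ws.
Qed.

Lemma decomposable_sum (K : Type) (r : seq K) (P : pred K) (d : K -> T -> T -> R) :
  (forall k, P k -> decomposable (d k)) ->
  decomposable (fun x y => \sum_(k <- r | P k) d k x y).
Proof.
move=> dec; elim: r => [|k r IH].
  by apply: decomposable_ext decomposable0 => x y _; rewrite big_nil.
case: (boolP (P k)) => Pk.
  apply: decomposable_ext (decomposableD (dec k Pk) IH) => x y _.
  by rewrite big_cons Pk.
by apply: decomposable_ext IH => x y _; rewrite big_cons (negPf Pk).
Qed.

Lemma decomposable_sym d x y : decomposable d -> x != y -> d x y = d y x.
Proof.
move=> [w [_ w1 _ _ ws]] xy; rewrite -ws // -ws 1?eq_sym //.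
by apply: eq_bigr => z _.
Qed.

(** Every pair in the support of [p] is joined to every apex in the support of
    [q]; the last hypothesis keeps the apex off the pair. *)
Lemma decomposable_join p (q : T -> R) :
  (forall x y, 0 <= p x y) -> (forall x y, p x y = p y x) ->
  (forall x, p x x = 0) -> (forall x, 0 <= q x) ->
  (forall x y, p x y * q x = 0) ->
  decomposable (fun x y => p x y * (\sum_z q z) + q y * (\sum_z p x z)
                           + q x * (\sum_z p y z)).
Proof.
move=> p0 ps pd q0 pq.
exists (fun x y z => p x y * q z + p x z * q y + p y z * q x).
split=> [x y z|x y z|x y z|x y|x y xy].
- by rewrite !addr_ge0 // mulr_ge0.
- by rewrite (ps x y); ring.
- by rewrite (ps y z); ring.
- by rewrite pd pq mul0r !addr0.
- by rewrite !big_split /= -!mulr_suml -mulr_sumr; ring.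
Qed.

Lemma decomposable_clique A : (2 < #|A|)%N ->
  decomposable (fun x y => (x \in A)%:R * (y \in A)%:R).
Proof.
move=> A2.
pose w x y z : R := ((uniq [:: x; y; z]) && all (mem A) [:: x; y; z])%:R.
have c0 : 0 < (#|A|.-2)%:R :> R by rewrite ltr0n; lia.
have dec : decomposable (fun x y => (#|A|.-2)%:R * ((x \in A)%:R * (y \in A)%:R)).
  exists w; split=> [x y z|x y z|x y z|x y|x y xy]; rewrite /w /=.
  - by rewrite ler0n.
  - rewrite !inE !andbT (eq_sym y x); congr (nat_of_bool _)%:R.
    by case: (x == y) (x == z) (y == z) (x \in A) (y \in A) (z \in A)
      => [] [] [] [] [] [].
  - rewrite !inE !andbT (eq_sym z y); congr (nat_of_bool _)%:R.
    by case: (x == y) (x == z) (y == z) (x \in A) (y \in A) (z \in A)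
      => [] [] [] [] [] [].
  - by rewrite !inE eqxx.
  - case: (boolP (x \in A)) => xA; last first.
      by rewrite big1 ?mul0r ?mulr0 // => z _; rewrite !inE /= ?andbF.
    case: (boolP (y \in A)) => yA; last first.
      by rewrite big1 ?mul0r ?mulr0 // => z _; rewrite !inE /= ?andbF.
    rewrite !mulr1 -natr_sum; congr _%:R.
    under eq_bigr => z _ do rewrite !inE !andbT (negPf xy) /=.
    have -> : #|A|.-2 = #|A :\ x :\ y|.
      by rewrite (cardsD1 x A) (cardsD1 y (A :\ x)) xA !inE eq_sym xy yA.
    rewrite -sum1_card [RHS]big_mkcond; apply: eq_bigr => z _.
    rewrite !inE (eq_sym z x) (eq_sym z y) ?(negPf xy) /=.
    by case: (x == z) (y == z) (z \in A) => [] [] [].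
have ci : 0 <= (#|A|.-2)%:R^-1 :> R by rewrite invr_ge0 ltW.
apply: decomposable_ext (decomposableZ ci dec) => x y _.
by rewrite mulKf ?gt_eqF.
Qed.

End Decomposable.

(** * Fractional missing pairs *)
Lemma unit_interval_cases (R : realFieldType) (x : R) :
  0 <= x <= 1 -> [\/ x = 0, x = 1 | 0 < x < 1].
Proof.
case/andP; rewrite !le_eqVlt => /predU1P[<-|x0]; first by constructor 1.
by case/predU1P => [->|x1]; [constructor 2 | constructor 3; rewrite x0].
Qed.

Section Hull.
Variables (R : realFieldType) (E : finType) (P : (E -> R) -> Prop) (k : nat).
Hypothesis P_ext : forall f g, f =1 g -> P f -> P g.
Hypothesis P_convex : forall f g (a b : R), 0 < a -> 0 < b -> P f -> P g ->
  P (fun e => (a * f e + b * g e) / (a + b)).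

(** The polytope [0 <= f <= 1], [\sum f <= k] has 0/1 vertices because [k] is an
    integer: mass can be moved in both directions between two fractional
    coordinates until one of them becomes an integer, and a single fractional
    coordinate may be rounded up as well as down.  Zeros of [f] stay zeros, so only
    vertices supported in the support of [f] occur. *)
Lemma hull_ind (f : E -> R) :
  (forall e, 0 <= f e <= 1) -> \sum_e f e <= k%:R ->
  (forall g : E -> bool, (forall e, g e -> 0 < f e) ->
     (\sum_e g e <= k)%N -> P (fun e => (g e)%:R)) ->
  P f.
Proof.
have [n] := ubnP #|[set e | 0 < f e < 1]|; elim: n f => // n IH f nf f01 fk Pg.
have [/eqP|] := posnP #|[set e | 0 < f e < 1]|.
  rewrite cards_eq0 => /eqP F0.
  have fE e : f e = (f e == 1)%:R.
    have := in_set0 e; rewrite -F0 inE.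
    by case: (unit_interval_cases (f01 e)) => ->; rewrite ?eqxx // eq_sym oner_eq0.
  apply: (P_ext (fun e => esym (fE e))); apply: Pg => [e /eqP -> //|].
  by rewrite -(ler_nat R) natr_sum; under eq_bigr do rewrite -fE.
case/card_gt0P => e1; rewrite inE => F1.
(* changing [f] at fractional points only keeps its zeros and its ones *)
have step g : (forall e, 0 <= g e <= 1) -> \sum_e g e <= k%:R ->
    (forall e, f e = 0 -> g e = 0) -> (forall e, f e = 1 -> g e = 1) ->
    (exists2 e, 0 < f e < 1 & ~~ (0 < g e < 1)) -> P g.
  move=> g01 gk g0 g1 [e fe ge]; apply: IH => // [|b bg].
    rewrite -ltnS; apply: leq_trans nf; rewrite ltnS; apply: proper_card.
    apply/properP; split; last by exists e; rewrite inE // (negPf ge).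
    apply/subsetP => x; rewrite !inE => gx.
    by case: (unit_interval_cases (f01 x)) => // [/g0|/g1] gE; lra.
  apply: Pg => x /bg; case: (unit_interval_cases (f01 x)) => [/g0|fx _|/andP[]//].
    by lra.
  by rewrite fx ltr01.
pose upd (g : E -> R) e v x := if x == e then v else g x.
have sumU (g : E -> R) e v : \sum_x upd g e v x = \sum_x g x - g e + v.
  rewrite (bigD1 e) //= [in RHS](bigD1 e) //= /upd eqxx.
  rewrite (eq_bigr g); first by ring.
  by move=> x /negPf ->.
case: (pickP [pred e | (e != e1) && (0 < f e < 1)]) => [e2 /=|no2].
  case/andP => e21 F2.
  pose mv t := upd (upd f e1 (f e1 + t)) e2 (f e2 - t).
  have summv t : \sum_x mv t x = \sum_x f x.
    by rewrite /mv !sumU /upd (negPf e21); ring.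
  have mvP t : - f e1 <= t <= 1 - f e1 -> f e2 - 1 <= t <= f e2 ->
     [|| t == - f e1, t == 1 - f e1, t == f e2 - 1 | t == f e2] -> P (mv t).
    move=> t1 t2 tc; apply: step => [e||e|e|]; rewrite ?summv //.
    - by rewrite /mv /upd; have := f01 e; case: eqP => _; [|case: eqP => _]; lra.
    - by rewrite /mv /upd; case: eqP => [->|_]; [|case: eqP => [->|_]]; lra.
    - by rewrite /mv /upd; case: eqP => [->|_]; [|case: eqP => [->|_]]; lra.
    - have [tc1|tc1] := boolP ((t == - f e1) || (t == 1 - f e1)).
        exists e1 => //; rewrite /mv /upd eq_sym (negPf e21) eqxx.
        by case/orP: tc1 => /eqP ->; lra.
      exists e2 => //; rewrite /mv /upd eqxx.
      case/or4P: tc => /eqP tE; move: tc1; rewrite tE ?eqxx ?orbT //; lra.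
  pose a := Num.min (f e1) (1 - f e2); pose b := Num.min (1 - f e1) (f e2).
  have a0 : 0 < a by rewrite lt_min; lra.
  have b0 : 0 < b by rewrite lt_min; lra.
  have Pa : P (mv (- a)).
    apply: mvP; rewrite /a; case: (leP (f e1) (1 - f e2)) => H; rewrite ?opprB ?eqxx ?orbT //; lra.
  have Pb : P (mv b).
    apply: mvP; rewrite /b; case: (leP (1 - f e1) (f e2)) => H; rewrite ?eqxx ?orbT //; lra.
  apply: P_ext (P_convex b0 a0 Pa Pb) => e.
  have ab : b + a != 0 by rewrite gt_eqF // addr_gt0.
  by rewrite /mv /upd; case: eqP => [->|_]; [|case: eqP => [->|_]]; field.
have sumI : exists m : nat, \sum_x f x = f e1 + m%:R.
  exists (\sum_(x | x != e1) (f x == 1%R))%N; rewrite (bigD1 e1) //= natr_sum.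
  congr (_ + _); apply: eq_bigr => x x1; have := no2 x; rewrite /= x1 /=.
  by case: (unit_interval_cases (f01 x)) => ->; rewrite ?eqxx // eq_sym oner_eq0.
case: sumI => m fm.
have mk : (m < k)%N by rewrite -(ltr_nat R); lra.
have P0 : P (upd f e1 0).
  apply: step => [e||e|e|].
  - by rewrite /upd; have := f01 e; case: eqP; lra.
  - by rewrite sumU; lra.
  - by rewrite /upd; case: eqP => [->|_]; lra.
  - by rewrite /upd; case: eqP => [->|_]; lra.
  - by exists e1 => //; rewrite /upd eqxx ltxx.
have P1 : P (upd f e1 1).
  apply: step => [e||e|e|].
  - by rewrite /upd; have := f01 e; case: eqP; lra.
  - rewrite sumU fm; have : m%:R + 1 <= k%:R :> R by rewrite natr1 ler_nat.
    by lra.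
  - by rewrite /upd; case: eqP => [->|_]; lra.
  - by rewrite /upd; case: eqP => [->|_]; lra.
  - by exists e1 => //; rewrite /upd eqxx ltxx andbF.
have q0 : 0 < 1 - f e1 by lra.
have q1 : 0 < f e1 by lra.
apply: P_ext (P_convex q0 q1 P0 P1) => e.
by rewrite /upd; case: eqP => [->|_]; field; rewrite subrK oner_eq0.
Qed.

End Hull.

Section Resilience.
Variables (R : realFieldType) (T : finType).
Implicit Types (f : T -> T -> R) (A : {set T}).

Definition weighting f :=
  [/\ forall x y, 0 <= f x y <= 1, forall x y, f x y = f y x & forall x, f x x = 0].

(** Unordered pairs count twice here, which is why the allowance [#|A| - 4]
    appears doubled below. *)
Definition total_weight A f : R := \sum_(x in A) \sum_(y in A) f x y.

Definition demand A f (x y : T) : R := (x \in A)%:R * (y \in A)%:R * (1 - f x y).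

(** The induction hypothesis.  It speaks of fractional sets of missing pairs
    because the slack of a deletion is spent fractionally. *)
Definition resilient A := forall f, weighting f ->
  total_weight A f <= 2 * (#|A|%:R - 4) -> decomposable (demand A f).

Lemma eq_total_weight A f g : {in A &, forall x y, f x y = g x y} ->
  total_weight A f = total_weight A g.
Proof. by move=> fg; apply: eq_bigr => x xA; apply: eq_bigr => y yA; apply: fg. Qed.

(** The coordinates of the polytope are the pairs of [A] ordered by their ranks,
    so that each unordered pair is one coordinate. *)
Lemma resilient_of_graphs A : (4 <= #|A|)%N ->
  (forall h : rel T, symmetric h -> irreflexive h ->
     total_weight A (fun x y => (h x y)%:R) <= 2 * (#|A|%:R - 4) ->
     decomposable (demand A (fun x y => (h x y)%:R))) ->
  resilient A.
Proof.
move=> A4 graphs f [f01 fs fd] fA.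
pose k := (#|A| - 4)%N; have kR : k%:R = #|A|%:R - 4 :> R by rewrite natrB.
pose lt (e : T * T) := (enum_rank e.1 < enum_rank e.2)%N.
pose dom e := [&& e.1 \in A, e.2 \in A & lt e].
pose phi (e : T * T) := if dom e then f e.1 e.2 else 0.
pose un (psi : T * T -> R) x y := psi (x, y) + psi (y, x).
have weight_un psi : (forall e, ~~ dom e -> psi e = 0) ->
    total_weight A (un psi) = 2 * \sum_e psi e.
  move=> psi0; rewrite /total_weight /un.
  under eq_bigr => x _ do rewrite big_split /=.
  rewrite big_split /= [X in _ + X]exchange_big /= -mulr2n mulr_natl; congr (_ *+ _).
  rewrite pair_big /= big_mkcond; apply: eq_bigr => -[x y] _ /=.
  case: ifP => // /negbT nA; rewrite psi0 // /dom /=.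
  by apply: contra nA => /and3P[-> ->].
have phi0 e : ~~ dom e -> phi e = 0 by rewrite /phi => /negPf ->.
have phiE : {in A &, forall x y, un phi x y = f x y}.
  move=> x y xA yA; rewrite /un /phi /dom /lt /= xA yA /=.
  case: (ltngtP (enum_rank x) (enum_rank y)) => [_|_|/val_inj/enum_rank_inj ->].
  - by rewrite addr0.
  - by rewrite add0r fs.
  - by rewrite addr0 fd.
have demand_eq g h : {in A &, forall x y, g x y = h x y} ->
    decomposable (demand A g) -> decomposable (demand A h).
  move=> gh; apply: decomposable_ext => x y _; rewrite /demand.
  by case: (boolP (x \in A)) => [xA|_]; case: (boolP (y \in A)) => [yA|_];
    rewrite ?mul0r ?mulr0 ?mul0r // gh.
apply: (demand_eq _ _ phiE).
apply: (@hull_ind R _ (fun psi => decomposable (demand A (un psi))) k).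
- move=> g h gh; apply: (demand_eq) => x y _ _; by rewrite /un !gh.
- move=> g h a b a0 b0 dg dh; have ab0 : 0 < a + b by rewrite addr_gt0.
  have qa : 0 <= a / (a + b) by rewrite divr_ge0 // ltW.
  have qb : 0 <= b / (a + b) by rewrite divr_ge0 // ltW.
  apply: decomposable_ext (decomposableD (decomposableZ qa dg) (decomposableZ qb dh)).
  by move=> x y _; rewrite /demand /un; field; rewrite gt_eqF.
- by move=> e; rewrite /phi; case: ifP => _; rewrite ?f01 // lexx ler01.
- have := weight_un _ phi0; rewrite (eq_total_weight phiE) kR; lra.
move=> g gphi gk.
have gdom e : g e -> dom e.
  by move/gphi; rewrite /phi; case: ifP => //; rewrite ltxx.
pose h x y := g (x, y) || g (y, x).
have hE x y : un (fun e => (g e)%:R) x y = (h x y)%:R.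
  rewrite /un /h; case: (boolP (g (x, y))) => [/gdom/and3P[_ _ gxy]|_].
    case: (boolP (g (y, x))) => [/gdom/and3P[_ _ gyx]|_]; last by rewrite addr0.
    by move: gxy gyx; rewrite /lt /=; lia.
  by rewrite add0r.
apply: (demand_eq (fun x y => (h x y)%:R)) => [x y _ _|]; first by rewrite hE.
apply: graphs => [x y|x|].
- by rewrite /h orbC.
- by apply/negP; rewrite /h orbb => /gdom /and3P[_ _]; rewrite /lt ltnn.
rewrite -(@eq_total_weight A (un (fun e => (g e)%:R))); last by move=> x y _ _.
rewrite weight_un; last by move=> e; apply: contraNeq; rewrite pnatr_eq0 eqb0 negbK => /gdom.
by rewrite ler_pM2l // -natr_sum -kR ler_nat.
Qed.

End Resilience.

(** * Counting missing pairs *)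
Section Missing.
Variables (T : finType) (h : rel T).
Hypotheses (h_sym : symmetric h) (h_irr : irreflexive h).
Implicit Types (A L : {set T}) (x y : T).

Definition degree A x : nat := \sum_(y in A) h x y.
Definition missing A : nat := \sum_(x in A) degree A x.

Lemma degreeD1 A x y : y \in A -> degree A x = (degree (A :\ y) x + h x y)%N.
Proof. by move=> yA; rewrite /degree (big_setD1 y) //= addnC. Qed.

Lemma missingD1 A x : x \in A -> missing A = (missing (A :\ x) + 2 * degree A x)%N.
Proof.
move=> xA; rewrite /missing (big_setD1 x) //=.
under eq_bigr => y _ do rewrite (degreeD1 y xA) h_sym.
rewrite big_split /=; have := degreeD1 x xA; rewrite h_irr /degree; lia.
Qed.

Lemma missing_even A : exists k, missing A = (2 * k)%N.
Proof.
have [n] := ubnP #|A|; elim: n A => // n IH A An.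
have [A0|[x xA]] := set_0Vmem A; first by exists 0%N; rewrite A0 /missing big_set0.
have [|k mk] := IH (A :\ x); first by move: An; rewrite (cardsD1 x A) xA; lia.
by exists (k + degree A x)%N; rewrite (missingD1 xA) mk mulnDr.
Qed.

Lemma degree_missing A x : x \in A -> (2 * degree A x <= missing A)%N.
Proof. by move=> xA; rewrite (missingD1 xA) leq_addl. Qed.

Lemma degree_gt0 A x : (0 < degree A x)%N -> exists2 y, y \in A & h x y.
Proof.
rewrite lt0n => /eqP nz; apply/exists_inP; apply: contraT => no; case: nz.
by apply: big1 => y yA; apply/eqP; rewrite eqb0; exact: (exists_inPn no).
Qed.

Lemma degree_eq0 A x y : degree A x = 0%N -> y \in A -> h x y = false.
Proof.
by move=> /eqP; rewrite sum_nat_eq0 => /forall_inP H /H; rewrite eqb0 => /negPf.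
Qed.

Lemma missing_eq0 A x y : missing A = 0%N -> x \in A -> y \in A -> h x y = false.
Proof.
by move=> /eqP; rewrite sum_nat_eq0 => /forall_inP H /H/eqP; apply: degree_eq0.
Qed.

Lemma nonneighbor A x : x \in A -> (degree A x < #|A|.-1)%N ->
  exists2 y, y \in A :\ x & ~~ h x y.
Proof.
move=> xA dx; apply/exists_inP; apply: contraTT dx => no; rewrite -leqNgt.
rewrite (degreeD1 _ xA) (cardsD1 x A) xA /= h_irr addn0 -sum1_card.
by apply: leq_sum => y yA; have := exists_inPn no y yA; rewrite negbK => ->.
Qed.

(** Matching two vertices that are not a missing pair removes two vertices, so the
    bound [missing A <= 2 * (#|A| - 3)] survives if at least two missing pairs
    disappear.  If only one is left, it is enough that this one disappears. *)
Lemma independent_pair A : (0 < missing A)%N -> (missing A + 6 <= 2 * #|A|)%N ->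
  exists x y, [/\ x \in A, y \in A, x != y, ~~ h x y &
    (2 <= degree A x + degree A y)%N ||
    ((missing A == 2) && (0 < degree A x))]%N.
Proof.
move=> m0 m6.
have nonnbr x : x \in A -> exists y, [/\ y \in A, x != y & ~~ h x y].
  move=> xA; have := degree_missing xA => dx.
  have [|y] := @nonneighbor A x xA; first by lia.
  by rewrite !inE eq_sym => /andP[xy yA] nxy; exists y.
have [/exists_inP[x xA dx]|] := boolP [exists x in A, 2 <= degree A x]%N.
  have [y [yA xy nxy]] := nonnbr x xA; exists x, y; split=> //.
  by rewrite (leq_trans dx) ?leq_addr.
move/exists_inPn => d1.
have [x xA dx] : exists2 x, x \in A & (0 < degree A x)%N.
  apply/exists_inP; apply: contraLR m0 => no; rewrite -eqn0Ngt.
  by rewrite sum_nat_eq0; apply/forall_inP => x xA; rewrite -leqn0 leqNgt (exists_inPn no).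
have [m2|m2] := eqVneq (missing A) 2%N.
  have [y [yA xy nxy]] := nonnbr x xA; exists x, y; split=> //.
  by rewrite dx orbT.
have [w wA xw] := degree_gt0 dx.
have xNw : x != w by apply: contraTneq xw => ->; rewrite h_irr.
have wAx : w \in A :\ x by rewrite !inE eq_sym xNw.
have dw := d1 w wA; have dx1 := d1 x xA.
have m4 := missingD1 xA; have m5 := missingD1 wAx.
have dwx := degreeD1 w xA; rewrite h_sym xw in dwx.
have [y yB dy] : exists2 y, y \in A :\ x :\ w & (0 < degree (A :\ x :\ w) y)%N.
  apply/exists_inP; apply: contraT => no.
  have m7 : missing (A :\ x :\ w) = 0%N.
    apply: big1 => y yB; apply/eqP; rewrite -leqn0 leqNgt.
    exact: (exists_inPn no).
  have : (missing A <= 2)%N by lia.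
  by have := degree_missing xA; move: m2 => /eqP; lia.
move: (yB); rewrite !inE => /and3P[yw yx yA].
have yAw : y \in A :\ w by rewrite !inE yw.
exists x, y; split=> //; first by rewrite eq_sym.
  by move: dx1 (degreeD1 x wA) (degreeD1 x yAw); rewrite xw; clear; lia.
by move: dx dy (degreeD1 y xA) (degreeD1 y wAx); clear; lia.
Qed.

End Missing.

(** * Fractional perfect matchings in nearly complete graphs *)
Section Matching.
Variables (R : realFieldType) (T : finType) (h : rel T).
Hypotheses (h_sym : symmetric h) (h_irr : irreflexive h).

(** Pairs are matched off by [independent_pair] until no missing pair is left; on
    a complete graph with at least two vertices the uniform weights work. *)
Lemma fractional_perfect_matching (L : {set T}) :
  ((1 < #|L|) && (missing h L == 0) || (missing h L + 6 <= 2 * #|L|))%N ->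
  exists f : T -> T -> R,
    [/\ forall x y, 0 <= f x y, forall x y, f x y = f y x,
        forall x y, [|| x \notin L, y \notin L, x == y | h x y] -> f x y = 0
      & forall x, x \in L -> \sum_y f x y = 1].
Proof.
have [n] := ubnP #|L|; elim: n L => // n IH L Ln HL.
have [m0|m0] := posnP (missing h L).
  have L1 : (1 < #|L|)%N by move: HL; rewrite m0; lia.
  have c0 : 0 < (#|L|.-1)%:R :> R by rewrite ltr0n; lia.
  exists (fun x y => [&& x \in L, y \in L & x != y]%:R / (#|L|.-1)%:R).
  split=> [x y|x y|x y|x xL].
  - by rewrite divr_ge0 ?ler0n ?ltW.
  - by rewrite andbCA eq_sym.
  - case: (boolP (x \in L)) => xL; case: (boolP (y \in L)) => yL //=; rewrite ?mul0r //.
    by rewrite (missing_eq0 m0 xL yL) orbF => ->; rewrite mul0r.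
  rewrite -mulr_suml -natr_sum xL /=.
  rewrite (_ : (\sum_y _)%N = #|L|.-1) ?divff ?gt_eqF //.
  rewrite (cardsD1 x L) xL /= -sum1_card [RHS]big_mkcond.
  by apply: eq_bigr => y _; rewrite !inE andbC eq_sym; case: ifP.
have m6 : (missing h L + 6 <= 2 * #|L|)%N by move: HL; lia.
have [x [y [xL yL xy nxy dxy]]] := independent_pair h_sym h_irr m0 m6.
have yLx : y \in L :\ x by rewrite !inE eq_sym xy.
have mx := missingD1 h_sym h_irr xL; have my := missingD1 h_sym h_irr yLx.
have := degreeD1 h y xL; rewrite h_sym (negPf nxy) addn0 => dy.
have cL : #|L| = #|L :\ x :\ y|.+2 by rewrite (cardsD1 x L) xL (cardsD1 y (L :\ x)) yLx.
have [||f [f0 fs fz f1]] := IH (L :\ x :\ y).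
- by move: Ln; rewrite cL; lia.
- move: dxy m6; rewrite cL; lia.
pose e u v := ((u == x) && (v == y) || (u == y) && (v == x)).
exists (fun u v => f u v + (e u v)%:R); split=> [u v|u v|u v|u uL].
- by rewrite addr_ge0.
- by rewrite fs /e orbC andbC (andbC (u == x)).
- move=> uv; rewrite fz; last first.
    by move: uv; rewrite !inE; case: (u == x) (u == y) (v == x) (v == y) => [] [] [] [];
      rewrite //= ?orbT.
  rewrite add0r; apply/eqP; rewrite pnatr_eq0 eqb0.
  apply: contraTN uv => /orP[] /andP[/eqP-> /eqP->]; rewrite xL yL //=.
    by rewrite (negPf xy) (negPf nxy).
  by rewrite eq_sym (negPf xy) h_sym (negPf nxy).
rewrite big_split /=.
have [->|ux] := eqVneq u x.
  rewrite big1 ?add0r; last by move=> v _; rewrite fz // !inE eqxx andbF.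
  rewrite (bigD1 y) //= /e !eqxx /= big1 ?addr0 // => v /negPf ->.
  by rewrite (negPf xy).
have [->|uy] := eqVneq u y.
  rewrite big1 ?add0r; last by move=> v _; rewrite fz // !inE eqxx.
  rewrite (bigD1 x) //= /e !eqxx orbT /= big1 ?addr0 // => v /negPf ->.
  by rewrite eq_sym (negPf xy).
rewrite f1 ?big1 ?addr0 ?inE ?uL ?ux ?uy // => v _.
by rewrite /e (negPf ux) (negPf uy).
Qed.

End Matching.

(** * Deleting vertices *)
Section Deletion.
Variables (R : realFieldType) (T : finType) (h : rel T) (A : {set T}).
Hypotheses (h_sym : symmetric h) (h_irr : irreflexive h).
Hypothesis smaller : forall B : {set T}, (7 <= #|B| < #|A|)%N -> resilient R B.
Hypothesis few_missing : (missing h A + 8 <= 2 * #|A|)%N.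

Local Notation graph B := (demand B (fun x y => (h x y)%:R : R)).

Lemma total_weight_missing (B : {set T}) :
  total_weight B (fun x y => (h x y)%:R : R) = (missing h B)%:R.
Proof. by rewrite /total_weight /missing natr_sum; apply: eq_bigr => x _; rewrite natr_sum. Qed.

Lemma missingS (B C : {set T}) : B \subset C -> (missing h B <= missing h C)%N.
Proof.
move=> BC; rewrite /missing /degree [leqRHS](big_setID B) /= (setIidPr BC).
apply: leq_trans (leq_addr _ _); apply: leq_sum => x _.
by rewrite [leqRHS](big_setID B) /= (setIidPr BC) leq_addr.
Qed.

(** The deletion of [u] frees [degree h A u] missing pairs at the price of one
    unit of the allowance.  What remains pays for the deletion of [V], one unit per
    vertex, and for the additional missing weight [f]. *)
Lemma decomposable_delete u (V : {set T}) (f : T -> T -> R) :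
  u \in A -> V \subset A :\ u -> (8 + #|V| <= #|A|)%N ->
  (forall x y, 0 <= f x y) -> (forall x y, f x y = f y x) -> (forall x, f x x = 0) ->
  (forall x y, (h x y)%:R + f x y <= 1) ->
  2 * #|V|%:R + 2 + total_weight (A :\ u :\: V) f <= 2 * (degree h A u)%:R ->
  decomposable (demand (A :\ u :\: V) (fun x y => (h x y)%:R + f x y)).
Proof.
move=> uA VA V8 f0 fs fd hf fV.
have cB : #|A :\ u :\: V| = (#|A| - 1 - #|V|)%N.
  by rewrite cardsD (setIidPr VA) (cardsD1 u A) uA /=; lia.
apply: smaller; first by rewrite cB; lia.
  split=> [x y|x y|x].
  - by rewrite addr_ge0 ?ler0n ?hf.
  - by rewrite h_sym fs.
  - by rewrite h_irr fd addr0.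
have -> : total_weight (A :\ u :\: V) (fun x y => (h x y)%:R + f x y) =
    (missing h (A :\ u :\: V))%:R + total_weight (A :\ u :\: V) f.
  rewrite -total_weight_missing /total_weight -big_split; apply: eq_bigr => x _.
  by rewrite -big_split.
have m1 : (missing h (A :\ u :\: V) + 2 * degree h A u + 8 <= 2 * #|A|)%N.
  apply: leq_trans few_missing; rewrite leq_add2r (missingD1 h_sym h_irr uA).
  by rewrite leq_add2r missingS // subsetDl.
have := m1; rewrite -(ler_nat R) natrM 2!natrD natrM => m1R.
have cR : #|A :\ u :\: V|%:R = #|A|%:R - 1 - #|V|%:R :> R.
  by rewrite cB !natrB //; lia.
rewrite cR; lra.
Qed.

(** Each pair survives in all but two of the vertex deletions. *)
Lemma decomposable_average : (8 <= #|A|)%N ->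
  (forall x, x \in A -> missing h (A :\ x) + 10 <= 2 * #|A|)%N ->
  decomposable (graph A).
Proof.
move=> A8 Hx.
have dec x : x \in A -> decomposable (graph (A :\ x)).
  move=> xA; have cx : #|A| = #|A :\ x|.+1 by rewrite (cardsD1 x A) xA.
  apply: smaller; first by lia.
    by split=> [y z|y z|y]; rewrite ?ler0n ?lern1 ?leq_b1 ?h_irr // h_sym.
  have := Hx x xA; rewrite total_weight_missing -(ler_nat R) cx natrM natrD -natr1.
  by lra.
have c0 : 0 < #|A|%:R - 2 :> R.
  by rewrite subr_gt0 (ltr_nat R 2); lia.
have ci : 0 <= (#|A|%:R - 2)^-1 :> R by rewrite invr_ge0 ltW.
apply: decomposable_ext (decomposableZ ci (decomposable_sum (index_enum T) dec)).
move=> x y xy; rewrite /demand.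
case: (boolP (x \in A)) => xA; last first.
  by rewrite big1 ?mulr0 ?mul0r // => z _; rewrite !inE (negPf xA) andbF !mul0r.
case: (boolP (y \in A)) => yA; last first.
  by rewrite big1 ?mulr0 ?mul0r // => z _; rewrite !inE (negPf yA) andbF mulr0 mul0r.
have yAx : y \in A :\ x by rewrite !inE eq_sym xy.
rewrite (bigD1 x) //= (bigD1 y) /=; last by rewrite yA eq_sym.
rewrite !inE !eqxx !mul0r mulr0 mul0r !add0r !mul1r.
rewrite (eq_bigr (fun=> 1 - (h x y)%:R)); last first.
  move=> z /andP[/andP[_ zx] zy]; rewrite !inE xA yA (eq_sym x) (eq_sym y) zx zy.
  by rewrite !mul1r.
rewrite (eq_bigl (mem (A :\ x :\ y))); last first.
  by move=> z; rewrite !inE; case: (z \in A) (z == x) (z == y) => [] [] [].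
rewrite sumr_const -[X in _ * X]mulr_natl (_ : #|A :\ x :\ y|%:R = #|A|%:R - 2).
  by rewrite mulKf // gt_eqF.
by rewrite (cardsD1 x A) xA (cardsD1 y (A :\ x)) yAx !natrD /=; ring.
Qed.

(** Let [g = #|A| - 1 - degree h A c] be the number of vertices joined to [c].  At
    most [g - 3] pairs are missing among them, so they carry a fractional perfect
    matching, of total weight [g / 2].  Triangles through [c] with these weights
    cover the pairs at [c], and the slack [degree h A c - 1] is at least [g / 2]. *)
Lemma decomposable_hub c : (8 <= #|A|)%N -> c \in A ->
  (#|A| < 3 * degree h A c)%N -> decomposable (graph A).
Proof.
move=> A8 cA Dc; pose L := [set y in A :\ c | ~~ h c y].
have LA : L \subset A :\ c by apply/subsetP => y; rewrite inE => /andP[].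
have cL : (#|L| + degree h A c).+1 = #|A|.
  rewrite (degreeD1 h c cA) h_irr addn0 (cardsD1 c A) cA add1n; congr _.+1.
  rewrite -(cardsID [set y | ~~ h c y] (A :\ c)); congr (_ + _)%N.
    by apply: eq_card => y; rewrite !inE.
  rewrite /degree -sum1_card [LHS]big_mkcond [RHS]big_mkcond; apply: eq_bigr => y _.
  by rewrite !inE; case: (y == c) (y \in A) (h c y) => [] [] [].
have mL := missingS LA; have mc := missingD1 h_sym h_irr cA.
have [|f [f0 fs fz f1]] := @fractional_perfect_matching R T h h_sym h_irr L.
  by apply/orP; right; lia.
have f1' x : \sum_y f x y = (x \in L)%:R.
  case: (boolP (x \in L)) => [/f1 //|xL]; rewrite big1 // => y _.
  by rewrite fz // xL.
have f_le1 x y : (h x y)%:R + f x y <= 1.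
  case: (boolP (h x y)) => hxy; first by rewrite fz ?addr0 // hxy !orbT.
  rewrite add0r; apply: (@le_trans _ _ (x \in L)%:R); last by rewrite lern1 leq_b1.
  by rewrite -f1' (bigD1 y) //= lerDl sumr_ge0.
have tf (B : {set T}) : total_weight B f <= #|L|%:R.
  apply: (@le_trans _ _ (\sum_x (x \in L)%:R)); last first.
    by rewrite -natr_sum ler_nat -sum1_card [leqRHS]big_mkcond leq_sum // => x _; case: ifP.
  rewrite /total_weight big_mkcond; apply: ler_sum => x _; case: ifP => // _.
  rewrite -f1' big_mkcond; apply: ler_sum => y _; by case: ifP.
have dec1 : decomposable (demand (A :\ c :\: set0) (fun x y => (h x y)%:R + f x y)).
  apply: decomposable_delete => //.
  - exact: sub0set.
  - by rewrite cards0 addn0.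
  - by move=> x; rewrite fz // eqxx !orbT.
  have : (#|L| + 2 <= 2 * degree h A c)%N by lia.
  by have := tf (A :\ c :\: set0); rewrite cards0 -(ler_nat R) natrD natrM; lra.
have dec2 := @decomposable_join R T f (fun x => (x == c)%:R) f0 fs
   (fun x => fz x x _) (fun x => ler0n _ _) _.
apply: decomposable_ext (decomposableD dec1 (dec2 _ _)); first last.
- by move=> x y; case: eqP => [->|_]; rewrite ?mulr0 // fz ?mul0r // !inE eqxx.
- by move=> x; rewrite eqxx !orbT.
move=> x y xy; rewrite /demand !f1' -natr_sum (bigD1 c) //= eqxx big1 ?addn0 ?mulr1; last first.
  by move=> z /negPf ->.
rewrite !inE; have [xc|xc] := eqVneq x c; have [yc|yc] := eqVneq y c; rewrite ?xc ?yc.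
- by rewrite xc yc eqxx in xy.
- rewrite fz ?inE ?eqxx //= cA; case: (y \in A) (h c y) => [] [] /=; ring.
- rewrite fz ?inE ?eqxx ?orbT //= cA h_sym; case: (x \in A) (h c x) => [] [] /=; ring.
rewrite /= !mul0r !addr0.
case: (boolP (x \in A)) => xA; last by rewrite fz ?inE ?(negPf xA) ?andbF // !mul0r addr0.
case: (boolP (y \in A)) => yA; last first.
  by rewrite (fz x y) ?inE ?(negPf yA) ?andbF ?orbT // mulr0 !mul0r addr0.
by rewrite !mul1r; ring.
Qed.

End Deletion.

(** * At most two vertices without missing pairs *)
Section FewIsolated.
Variables (R : realFieldType) (T : finType) (h : rel T) (A I : {set T}).
Hypotheses (h_sym : symmetric h) (h_irr : irreflexive h).
Hypothesis smaller : forall B : {set T}, (7 <= #|B| < #|A|)%N -> resilient R B.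
Hypothesis few_missing : (missing h A + 8 <= 2 * #|A|)%N.
Hypotheses (IA : I \subset A) (I_isolated : forall v, v \in I -> degree h A v = 0%N).

Local Notation graph B := (demand B (fun x y => (h x y)%:R : R)).
Local Notation J := (A :\: I).

(** Deleting [v] of [I] together with [x v] of [J] removes one coverage of every
    pair at [v], except that the pair of [v] and [x v] is not in that summand
    anyway; this last pair is dropped when [y v] is deleted.  As [x] is injective,
    pairs inside [I] lose two coverages.  The sum in the last hypothesis is the
    slack which [u] spends. *)
Lemma decomposable_assignment (x y : T -> T) :
  (9 <= #|A|)%N -> (3 <= #|J|)%N ->
  {in I, forall v, [/\ x v \in J, y v \in J & y v != x v]} -> {in I &, injective x} ->
  (forall u, u \in J -> \sum_(v in I) ((x v == u) + (y v == u)) < degree h A u)%N ->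
  decomposable (graph A).
Proof.
move=> A9 J3 xyJ x_inj deg.
pose V u := [set v in I | x v == u].
pose f u a b : R := ([&& a \in I, y a == u & b == x a] + [&& b \in I, y b == u & a == x b])%:R.
have JI a : a \in J -> a \in I = false by rewrite inE => /andP[/negPf].
have hI a b : a \in I -> b \in A -> h a b = false.
  by move=> aI bA; apply: degree_eq0 (I_isolated aI) bA.
have dec u : u \in J ->
    decomposable (demand (A :\ u :\: V u) (fun a b => (h a b)%:R + f u a b)).
  move=> uJ; have uA : u \in A by move: uJ; rewrite inE => /andP[].
  have := deg u uJ; rewrite big_split /= => du.
  have cV : #|V u| = (\sum_(v in I) (x v == u))%N.
    rewrite -sum1_card big_mkcond [RHS]big_mkcond; apply: eq_bigr => v _.
    by rewrite inE; case: (v \in I) (x v == u) => [] [].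
  apply: (decomposable_delete h_sym h_irr smaller few_missing) => //.
  - apply/subsetP => v; rewrite !inE => /andP[vI _]; rewrite (subsetP IA) // andbT.
    by apply: contraTneq uJ => <-; rewrite inE vI.
  - suff : (#|V u| <= 1)%N by lia.
    apply/card_le1_eqP => v w; rewrite !inE => /andP[vI /eqP xv] /andP[wI /eqP xw].
    by apply: x_inj; rewrite // xv xw.
  - by move=> a b; rewrite /f addnC.
  - move=> a; rewrite /f; case: (boolP (a \in I)) => //= aI.
    have [xJ _ _] := xyJ a aI; case: (a =P x a) => [ax|_]; rewrite ?andbF //.
    by move: xJ; rewrite -ax inE aI.
  - move=> a b; rewrite /f.
    case: (boolP (a \in I)) => aI; case: (boolP (b \in I)) => bI /=; rewrite ?addr0 ?add0n ?addn0.
    + have [xJ _ _] := xyJ a aI; have [xJb _ _] := xyJ b bI.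
      rewrite (hI a b aI) ?(subsetP IA) // add0r.
      case: (b =P x a) => [bx|_]; first by move: xJ; rewrite -bx inE bI.
      case: (a =P x b) => [ax|_]; first by move: xJb; rewrite -ax inE aI.
      by rewrite !andbF ler01.
    + case: (boolP (b \in A)) => bA; first by rewrite hI // add0r lern1 leq_b1.
      have [xJ _ _] := xyJ a aI; case: (b =P x a) => [bx|_]; last first.
        by rewrite andbF addr0 lern1 leq_b1.
      by move: xJ; rewrite -bx inE (negPf bA) andbF.
    + case: (boolP (a \in A)) => aA; first by rewrite h_sym hI // add0r lern1 leq_b1.
      have [xJ _ _] := xyJ b bI; case: (a =P x b) => [bx|_]; last first.
        by rewrite andbF addr0 lern1 leq_b1.
      by move: xJ; rewrite -bx inE (negPf aA) andbF.
    + by rewrite lern1 leq_b1.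
  have tf : total_weight (A :\ u :\: V u) (f u) <= 2 * (\sum_(v in I) (y v == u))%N%:R.
    pose F a b : R := [&& a \in I, y a == u & b == x a]%:R.
    have F_le (B : {set T}) : \sum_(a in B) \sum_(b in B) F a b <=
        (\sum_(v in I) (y v == u))%N%:R.
      rewrite natr_sum big_mkcond [leRHS]big_mkcond; apply: ler_sum => a _.
      case: (boolP (a \in I)) => aI; last first.
        by case: ifP => // _; rewrite big1 // => b _; rewrite /F (negPf aI).
      case: ifP => _; last by rewrite ler0n.
      rewrite big_mkcond (bigD1 (x a)) //= big1 ?addr0.
        by case: ifP => _; rewrite ?ler0n // /F aI eqxx andbT.
      by move=> b /negPf bx; rewrite /F bx !andbF; case: ifP.
    have -> : total_weight (A :\ u :\: V u) (f u) =
        \sum_(a in A :\ u :\: V u) \sum_(b in A :\ u :\: V u) F a b +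
        \sum_(a in A :\ u :\: V u) \sum_(b in A :\ u :\: V u) F b a.
      rewrite -big_split; apply: eq_bigr => a _; rewrite -big_split; apply: eq_bigr => b _.
      by rewrite /f natrD.
    rewrite [X in _ + X]exchange_big /=; have := F_le (A :\ u :\: V u); lra.
  have : (#|V u| + (\sum_(v in I) (y v == u)) + 1 <= degree h A u)%N by lia.
  by rewrite -(ler_nat R) 2!natrD; lra.
have c0 : 0 < #|J|%:R - 2 :> R by rewrite subr_gt0 (ltr_nat R 2).
have ci : 0 <= (#|J|%:R - 2)^-1 :> R by rewrite invr_ge0 ltW.
apply: decomposable_ext (decomposableZ ci (decomposable_sum (index_enum T) dec)).
move=> a b ab; rewrite /demand.
case: (boolP (a \in A)) => aA; last first.
  by rewrite big1 ?mulr0 ?mul0r // => u _; rewrite !inE (negPf aA) !andbF !mul0r.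
case: (boolP (b \in A)) => bA; last first.
  by rewrite big1 ?mulr0 ?mul0r // => u _; rewrite !inE (negPf bA) !andbF mulr0 mul0r.
(* a vertex is missing exactly from the summand indexed by its killer *)
pose k a := if a \in I then x a else a.
have kJ c : c \in A -> k c \in J.
  by move=> cA; rewrite /k; case: ifP => [/xyJ[]//|cI]; rewrite inE cI.
have kP c u : c \in A -> u \in J -> (c \in A :\ u :\: V u) = (u != k c).
  move=> cA uJ; rewrite !inE cA andbT /k; case: ifP => /= cI.
    rewrite (eq_sym u) andb_idr // => _; apply: contraTneq uJ => <-.
    by rewrite inE cI.
  by rewrite eq_sym.
rewrite (eq_bigr (fun u =>
  if (u != k a) && (u != k b) then 1 - ((h a b)%:R + f u a b) else 0)); last first.
  by move=> u uJ; rewrite !kP // -natrM mulnb; case: ifP; rewrite ?mul1r ?mul0r.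
rewrite -big_mkcondr !mul1r.
have [kab|kab] := eqVneq (k a) (k b); last first.
  rewrite (eq_bigr (fun=> 1 - (h a b)%:R)); last first.
    move=> u _; congr (1 - _); rewrite /f.
    case: (boolP (a \in I)) => aI; case: (boolP (b \in I)) => bI //=; rewrite ?addr0 //.
    + move: kab; rewrite /k aI bI (inj_in_eq x_inj) // => _.
      have [xa _ _] := xyJ a aI; have [xb _ _] := xyJ b bI.
      case: (b =P x a) => [bx|_]; first by move: xa; rewrite -bx inE bI.
      case: (a =P x b) => [ax|_]; first by move: xb; rewrite -ax inE aI.
      by rewrite !andbF addr0.
    + by move: kab; rewrite /k aI (negPf bI) eq_sym => /negPf ->; rewrite !andbF addr0.
    + by move: kab; rewrite /k (negPf aI) bI => /negPf ->; rewrite !andbF addr0.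
  rewrite (eq_bigl (mem (J :\ k a :\ k b))); last first.
    by move=> u; rewrite !inE; case: (u == k a) (u == k b) (u \in I) (u \in A) => [] [] [] [].
  rewrite sumr_const -[X in _ * X]mulr_natl (_ : #|J :\ k a :\ k b|%:R = #|J|%:R - 2).
    by rewrite mulKf // gt_eqF.
  have kbJ : k b \in J :\ k a by rewrite in_setD1 eq_sym kab kJ.
  by rewrite (cardsD1 (k a) J) kJ // (cardsD1 (k b) (J :\ k a)) kbJ !natrD /=; ring.
have [v [vI hab fE yv]] : exists v, [/\ v \in I, h a b = false,
    forall u, f u a b = (y v == u)%:R & y v != k a].
  move: kab; rewrite /k; case: (boolP (a \in I)) => aI; case: (boolP (b \in I)) => bI kab.
  - by move: ab; rewrite (x_inj _ _ aI bI kab) eqxx.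
  - exists a; split; [by []|by rewrite hI| |by have [] := xyJ a aI].
    by move=> u; rewrite /f aI (negPf bI) kab eqxx andbT addn0.
  - exists b; split; [by []|by rewrite h_sym hI| |by rewrite kab; have [] := xyJ b bI].
    by move=> u; rewrite /f bI (negPf aI) kab eqxx andbT add0n.
  - by move: ab; rewrite kab eqxx.
have [_ yJ _] := xyJ v vI.
have -> : 1 - (h a b)%:R = 1 :> R by rewrite hab subr0.
rewrite (bigD1 (y v)) /=; last by rewrite yJ -kab yv.
rewrite fE eqxx hab add0r subrr add0r.
rewrite (eq_bigr (fun=> 1)); last first.
  by move=> u /andP[_ uy]; rewrite fE eq_sym (negPf uy) addr0 subr0.
rewrite (eq_bigl (mem (J :\ k a :\ y v))); last first.
  by move=> u; rewrite -kab !inE; case: (u == k a) (u == y v) (u \in I) (u \in A) => [] [] [] [].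
rewrite sumr_const (_ : #|J :\ k a :\ y v|%:R = #|J|%:R - 2).
  by rewrite mulVf // gt_eqF.
have yvJ : y v \in J :\ k a by rewrite in_setD1 yv yJ.
by rewrite (cardsD1 (k a) J) kJ // (cardsD1 (y v) (J :\ k a)) yvJ !natrD /=; ring.
Qed.

Lemma pick_max (a : T -> nat) (B : {set T}) : (0 < \sum_(u in B) a u)%N ->
  exists u, [/\ u \in B, 0 < a u, forall w, w \in B -> a w <= a u &
    \sum_(w in B) a w = a u + \sum_(w in B :\ u) a w]%N.
Proof.
move=> s0; have [w wB aw] : exists2 w, w \in B & (0 < a w)%N.
  apply/exists_inP; apply: contraLR s0 => no; rewrite -eqn0Ngt sum_nat_eq0.
  by apply/forall_inP => w wB; rewrite -leqn0 leqNgt (exists_inPn no).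
case: (arg_maxnP a wB) => u uB umax; exists u; split=> //.
  exact: leq_trans aw (umax w wB).
by rewrite (big_setD1 u).
Qed.

(** The total slack is [#|A| + #|I| - 8], and no vertex has more than
    [(#|A| - 3) / 3] of it, so it is spread over enough vertices: the assignment is
    found by picking vertices of largest slack one after the other. *)
Lemma decomposable_few_isolated :
  (10 <= #|A|)%N -> (0 < #|I| <= 2)%N -> (missing h A + 8 = 2 * #|A|)%N ->
  {in J, forall u, 0 < degree h A u}%N -> {in A, forall u, 3 * degree h A u <= #|A|}%N ->
  decomposable (graph A).
Proof.
move=> A10 I2 tight Jdeg small.
pose a u := (degree h A u).-1.
have cJ : (#|J| + #|I| = #|A|)%N by rewrite cardsD (setIidPr IA) subnK // subset_leq_card.
have sa : (\sum_(u in J) a u + 8 = #|A| + #|I|)%N.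
  have : (\sum_(u in J) a u + #|J| = missing h A)%N.
    rewrite -sum1_card -big_split /= /missing [RHS](big_setID I) /= (setIidPr IA).
    rewrite [X in _ = (X + _)%N]big1 // add0n; apply: eq_bigr => u uJ.
    by rewrite /a; have := Jdeg u uJ; lia.
  lia.
have a_small u : u \in J -> (3 * a u + 3 <= #|A|)%N.
  move=> uJ; have uA : u \in A by move: uJ; rewrite inE => /andP[].
  by have := Jdeg u uJ; have := small u uA; rewrite /a; lia.
have aE u : u \in J -> degree h A u = (a u).+1.
  by move=> uJ; have := Jdeg u uJ; rewrite /a; lia.
have [|p [pJ ap pmax sp]] := @pick_max a J; first by lia.
have ap3 := a_small p pJ.
have [A9 J3] : (9 <= #|A|)%N /\ (3 <= #|J|)%N by lia.
have [|q [qJp aq qmax sq]] := @pick_max a (J :\ p); first by lia.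
have qJ : q \in J by move: qJp; rewrite in_setD1 => /andP[].
have qp : q != p by move: qJp; rewrite in_setD1 => /andP[].
have [I1|I1] := eqVneq #|I| 1%N.
  case/eqP/cards1P: I1 => v Iv.
  apply: (@decomposable_assignment (fun=> p) (fun=> q)) => //.
    by move=> v1 v2; rewrite Iv !inE => /eqP -> /eqP ->.
  move=> u uJ; rewrite aE // Iv big_set1.
  case: (p =P u) => [pu|_]; case: (q =P u) => [qu|_]; move: qp; rewrite ?pu ?qu ?eqxx //;
    move: ap aq; rewrite ?pu ?qu; clear; lia.
have I2' : #|I| == 2%N by move: I1 => /eqP I1; lia.
case/cards2P: (I2') => v [w [vw Ivw]].
have wv : w != v by rewrite eq_sym.
move/eqP: I2' => I2'.
have finish p1 q1 p2 q2 : [/\ p1 \in J, q1 \in J, p2 \in J & q2 \in J] ->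
    [&& p1 != p2, q1 != p1 & q2 != p2] ->
    (forall u, u \in J ->
      (p1 == u) + (q1 == u) + ((p2 == u) + (q2 == u)) <= a u)%N ->
    decomposable (graph A).
  move=> [p1J q1J p2J q2J] /and3P[p12 qp1 qp2] cnt.
  apply: (@decomposable_assignment (fun t => if t == v then p1 else p2)
                                   (fun t => if t == v then q1 else q2)) => //.
  - by move=> t _; case: ifP.
  - move=> t1 t2; rewrite Ivw !inE => /orP[] /eqP -> /orP[] /eqP -> //;
      rewrite eqxx (negPf wv) => pp; by rewrite pp eqxx in p12.
  move=> u uJ; rewrite aE // Ivw big_setU1 ?inE //= big_set1 eqxx (negPf wv).
  by rewrite ltnS cnt.
have [aq2|aq1] := ltnP 1 (a q).
  apply: (finish p q q p); rewrite ?qp 1?eq_sym ?qp // => u uJ.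
  move: (pmax q qJ) => apq.
  case: (p =P u) => [pu|_]; case: (q =P u) => [qu|_]; move: qp; rewrite ?pu ?qu ?eqxx //;
    move: apq aq2; rewrite ?pu ?qu; clear; lia.
have [|r [rJ' ar rmax sr]] := @pick_max a (J :\ p :\ q).
  by move: sa sp sq ap3 aq1 A10 I2'; clear; lia.
have [rq rp rJ] : [/\ r != q, r != p & r \in J].
  by move: rJ'; rewrite !in_setD1 => /and3P[].
have [ap2|ap1] := ltnP 1 (a p).
  apply: (finish p r q p); rewrite ?qp ?rp 1?eq_sym ?qp // => u uJ.
  case: (p =P u) => [pu|_]; case: (q =P u) => [qu|_]; case: (r =P u) => [ru|_];
    move: qp rp rq; rewrite ?pu ?qu ?ru ?eqxx //; move: ap2 aq ar; rewrite ?pu ?qu ?ru; clear; lia.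
have ar1 : (a r <= 1)%N.
  by apply: leq_trans aq1; apply: qmax; move: rJ'; rewrite in_setD1 => /andP[].
have [|s [sJ' as0 _ _]] := @pick_max a (J :\ p :\ q :\ r).
  by move: sa sp sq sr ap1 aq1 ar1 A10 I2'; clear; lia.
have [sr' sq' sp' sJ] : [/\ s != r, s != q, s != p & s \in J].
  by move: sJ'; rewrite !in_setD1 => /and4P[].
apply: (finish p q r s); rewrite ?qp ?sr' 1?eq_sym ?rp // => u uJ.
case: (p =P u) => [pu|_]; case: (q =P u) => [qu|_]; case: (r =P u) => [ru|_];
  case: (s =P u) => [su|_]; move: qp rp rq sr' sq' sp'; rewrite ?pu ?qu ?ru ?su ?eqxx //;
  move: ap aq ar as0; rewrite ?pu ?qu ?ru ?su; clear; lia.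
Qed.

End FewIsolated.

(** * At least three vertices without missing pairs *)
Section Balance.
Variables (R : realFieldType) (T : finType).

(** Only the triangles inside [J] are kept, and [rho] is the part of the demand
    inside [J] that the other triangles covered.  Such a triangle has a corner
    outside [J], so [rho] is bounded by the demand on the pairs leaving [J]; the
    gap between the two comes from triangles with two corners outside [J]. *)
Lemma decomposable_strip (D : T -> T -> R) (J : {set T}) : decomposable D ->
  exists rho : T -> T -> R,
    [/\ [/\ forall x y, 0 <= rho x y, forall x y, rho x y = rho y x,
            forall x, rho x x = 0 & forall x y, x \notin J -> rho x y = 0],
        decomposable (fun x y => (x \in J)%:R * (y \in J)%:R * D x y - rho x y),
        forall x, x \in J -> \sum_y rho x y <= \sum_(z in ~: J) D x z
      & \sum_(x in J) (\sum_(z in ~: J) D x z - \sum_y rho x y) <=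
        \sum_(z in ~: J) \sum_(t in ~: J | t != z) D z t].
Proof.
move=> [w [w0 w1 w2 wd ws]].
have wd' x y : w x y y = 0 by rewrite w1 w2 wd.
have w3 x y z : w x y z = w z y x by rewrite w1 w2 w1.
pose rho x y := (x \in J)%:R * (y \in J)%:R * \sum_(z in ~: J) w x y z.
have rho_sum x : x \in J -> \sum_y rho x y = \sum_(z in ~: J) \sum_(y in J) w x z y.
  move=> xJ; rewrite exchange_big [RHS]big_mkcond; apply: eq_bigr => y _.
  rewrite /rho xJ mul1r; case: (y \in J); rewrite ?mul0r // mul1r.
  by apply: eq_bigr => z _; rewrite w2.
have DJ x z : x \in J -> z \in ~: J ->
    D x z = \sum_(y in J) w x z y + \sum_(y in ~: J) w x z y.
  move=> xJ zJ; rewrite -ws; last by apply: contraTneq zJ => <-; rewrite inE xJ.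
  by rewrite (bigID (mem J)) /=; congr (_ + _); apply: eq_bigl => y; rewrite inE.
exists rho; split; first split.
- by move=> x y; rewrite /rho !mulr_ge0 ?ler0n // sumr_ge0.
- move=> x y; rewrite /rho (mulrC (x \in J)%:R); congr (_ * _).
  by apply: eq_bigr => z _.
- by move=> x; rewrite /rho big1 ?mulr0 // => z _; rewrite wd.
- by move=> x y /negPf xJ; rewrite /rho xJ !mul0r.
- pose j x : R := (x \in J)%:R.
  exists (fun x y z => j x * j y * j z * w x y z); split=> [x y z|x y z|x y z|x y|x y xy].
  + by rewrite !mulr_ge0 ?ler0n.
  + by rewrite w1; ring.
  + by rewrite w2; ring.
  + by rewrite wd mulr0.
  have -> : D x y = \sum_(z in J) w x y z + \sum_(z in ~: J) w x y z.
    rewrite -ws // (bigID (mem J)) /=; congr (_ + _); apply: eq_bigl => z.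
    by rewrite inE.
  rewrite /rho -mulrBr addrK mulr_sumr [RHS]big_mkcond; apply: eq_bigr => z _.
  by rewrite /j; case: (z \in J); rewrite ?mulr1 ?mulr0 ?mul0r.
- move=> x xJ; rewrite rho_sum //; apply: ler_sum => z zJ.
  by rewrite DJ // lerDl sumr_ge0.
rewrite (eq_bigr (fun x => \sum_(z in ~: J) \sum_(t in ~: J | t != z) w x z t)).
  rewrite exchange_big /=; apply: ler_sum => z _; rewrite exchange_big /=.
  apply: ler_sum => t /andP[tJ tz]; rewrite -ws 1?eq_sym // [leRHS](bigID (mem J)) /=.
  rewrite (eq_bigr (fun x => w z t x)) ?lerDl ?sumr_ge0 // => x _.
  by rewrite w1 w2.
move=> x xJ; rewrite rho_sum // -sumrB; apply: eq_bigr => z zJ.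
rewrite DJ // addrC addKr (bigID (fun t => t != z)) /= [X in _ + X]big1 ?addr0 //.
by move=> t /andP[_]; rewrite negbK => /eqP ->.
Qed.

Variables (h : rel T) (A I : {set T}).
Hypotheses (h_sym : symmetric h) (h_irr : irreflexive h) (IA : I \subset A).
Hypothesis I_isolated : forall v, v \in I -> degree h A v = 0%N.
Local Notation J := (A :\: I).
Local Notation i := (#|I|%:R : R).
Local Notation graph B := (demand B (fun x y => (h x y)%:R : R)).

(** The demand [D] is stripped to its triangles inside [J].  What is then
    missing from [lam] times the graph on [J] is covered by triangles with their
    third corner spread evenly over [I], so only row sums of [D] matter.  The
    pairs between [I] and [J] are filled up by triangles with two corners in
    [I], which is possible as the first inequality says that they are not covered
    too often; the pairs inside [I] are filled up by triangles inside [I], by the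
    second inequality.  In both, [#|J| - 1 - degree h A x] is the number of pairs
    at [x] inside [J]. *)
Lemma decomposable_balance (D : T -> T -> R) (mu lam : R) :
  (2 < #|I|)%N -> decomposable D -> 0 < lam -> mu <= lam ->
  {in J &, forall x y, x != y -> D x y = mu * (1 - (h x y)%:R)} ->
  (forall x y, x != y -> x \notin A -> D x y = 0) ->
  (forall x, x \in J -> \sum_(v in I) D x v
     + (lam - mu) * (#|J|%:R - 1 - (degree h A x)%:R) <= i * lam) ->
  \sum_(x in J) (i * lam - (lam - mu) * (#|J|%:R - 1 - (degree h A x)%:R)
     - \sum_(v in I) D x v) + \sum_(v in I) \sum_(t in I | t != v) D v t
    <= i * (i - 1) * lam ->
  decomposable (graph A).
Proof.
move=> I3 decD lam0 mulam DJ Dout Ha Hb.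
have [rho [[rho0 rhos rhod rhoJ] dec1 rho_le rho_sum]] := decomposable_strip J decD.
have i0 : 0 < i by rewrite ltr0n; lia.
have i1 : 0 < i - 1 by rewrite subr_gt0 ltr1n; lia.
have hI v y : v \in I -> y \in A -> h v y = false.
  by move=> vI; apply: degree_eq0; apply: I_isolated.
pose g x y : R := ([&& x \in J, y \in J & x != y])%:R * (1 - (h x y)%:R).
have g0 x y : 0 <= g x y.
  by rewrite mulr_ge0 ?ler0n // subr_ge0 lern1 leq_b1.
have gsum x : x \in J -> \sum_y g x y = #|J|%:R - 1 - (degree h A x)%:R.
  move=> xJ; have xA : x \in A by move: xJ; rewrite inE => /andP[].
  have dJ : degree h A x = (\sum_(y in J :\ x) h x y)%N.
    rewrite /degree (big_setID I) /= (setIidPr IA) big1 ?add0n; last first.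
      by move=> v vI; rewrite h_sym hI.
    by rewrite (big_setD1 x) //= h_irr.
  have -> : #|J|%:R - 1 = #|J :\ x|%:R :> R by rewrite (cardsD1 x J) xJ add1n -natr1 addrK.
  rewrite dJ natr_sum -sum1_card natr_sum -sumrB.
  rewrite [RHS]big_mkcond; apply: eq_bigr => y _.
  rewrite /g xJ in_setD1 (eq_sym y) /=.
  by case: (x == y); case: (y \in J); rewrite /= ?mul0r ?mul1r.
pose rho' x y := (lam - mu) * g x y + rho x y.
pose Y x := \sum_y rho' x y.
have YE x : x \in J -> Y x = (lam - mu) * (#|J|%:R - 1 - (degree h A x)%:R) + \sum_y rho x y.
  by move=> xJ; rewrite /Y /rho' big_split /= -mulr_sumr gsum.
have rho'J x y : x \notin J -> rho' x y = 0.
  by move=> xJ; rewrite /rho' rhoJ // /g (negPf xJ) mul0r mulr0 addr0.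
have rho's x y : rho' x y = rho' y x.
  by rewrite /rho' rhos /g h_sym andbCA eq_sym.
have Dsym x y : x != y -> D x y = D y x by apply: decomposable_sym.
have Xout x : x \in J -> \sum_(z in ~: J) D x z = \sum_(v in I) D x v.
  move=> xJ; have [xI xA] : x \notin I /\ x \in A by move: xJ; rewrite inE => /andP[].
  have xz z : z \in I -> z != x by apply: contraTneq => ->.
  rewrite [RHS]big_mkcond [LHS]big_mkcond; apply: eq_bigr => z _.
  rewrite !inE negb_and negbK; case: (boolP (z \in I)) => //= zI.
  case: ifP => // zA; have zx : z != x by apply: contraNneq zA => ->.
  by rewrite Dsym 1?eq_sym // Dout.
have IIout : \sum_(z in ~: J) \sum_(t in ~: J | t != z) D z t =
    \sum_(v in I) \sum_(t in I | t != v) D v t.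
  rewrite [LHS]big_mkcond [RHS]big_mkcond; apply: eq_bigr => z _.
  rewrite !inE negb_and negbK; case: (boolP (z \in I)) => //= zI.
    rewrite [LHS]big_mkcond [RHS]big_mkcond; apply: eq_bigr => t _.
    rewrite !inE negb_and negbK; case: (boolP (t \in I)) => //= tI.
    case: eqP => [_|/eqP tz]; rewrite ?andbF // andbT; case: ifP => // tA.
    by rewrite Dsym 1?eq_sym // Dout // tA.
  by case: ifP => // zA; rewrite big1 // => t /andP[_ tz]; rewrite Dout 1?eq_sym.
pose delta x := (x \in J)%:R * (i * lam - Y x).
have delta0 x : 0 <= delta x.
  rewrite /delta; case: (boolP (x \in J)) => xJ; rewrite ?mul0r // mul1r YE //.
  have := Ha x xJ; have := rho_le x xJ; rewrite Xout //; lra.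
have delta_le : \sum_x delta x <= i * (i - 1) * lam.
  apply: le_trans Hb; apply: (@le_trans _ _ (\sum_(x in J) (i * lam - Y x))).
    rewrite [leRHS]big_mkcond; apply: ler_sum => x _.
    by rewrite /delta; case: (x \in J); rewrite ?mul0r ?mul1r.
  rewrite -IIout -lerBlDl -sumrB; apply: le_trans rho_sum.
  by apply: ler_sum => x xJ; rewrite YE // Xout //; lra.
pose p x y : R := [&& x \in I, y \in I & x != y]%:R / (i * (i - 1)).
have psum x : \sum_y p x y = (x \in I)%:R / i.
  rewrite -mulr_suml -natr_sum; case: (boolP (x \in I)) => xI; last first.
    by rewrite big1 // !mul0r.
  rewrite (_ : (\sum_y _)%N = #|I :\ x|).
    have iE : i = 1 + #|I :\ x|%:R by rewrite (cardsD1 x I) xI natrD.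
    have -> : #|I :\ x|%:R = i - 1 by rewrite iE; ring.
    by rewrite /=; field; rewrite !gt_eqF.
  rewrite -sum1_card [RHS]big_mkcond; apply: eq_bigr => y _.
  by rewrite !inE eq_sym andbC; case: (y \in I) (y == x) => [] [].
have JI x : x \in J -> x \in I = false by rewrite inE => /andP[/negPf].
have qsum : \sum_z (z \in I)%:R = i :> R.
  by rewrite -natr_sum -sum1_card [in RHS]big_mkcond; congr _%:R; apply: eq_bigr => z _; case: ifP.
have dec2 : decomposable (fun x y =>
    rho' x y + (y \in I)%:R * (Y x / i) + (x \in I)%:R * (Y y / i)).
  have D2 := @decomposable_join R T (fun x y => rho' x y / i) (fun x => (x \in I)%:R).
  apply: decomposable_ext (D2 _ _ _ _ _) => [x y xy|x y|x y|x|x|x y].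
  - by rewrite qsum -!mulr_suml -/(Y x) -/(Y y) divfK // gt_eqF.
  - by rewrite divr_ge0 ?(ltW i0) // addr_ge0 // mulr_ge0 // subr_ge0.
  - by rewrite rho's.
  - by rewrite /rho' rhod /g eqxx !andbF mul0r mulr0 addr0 mul0r.
  - by rewrite ler0n.
  - case: (boolP (x \in J)) => [/JI ->|xJ]; first by rewrite mulr0.
    by rewrite rho'J // !mul0r.
have dec3 : decomposable (fun x y => p x y * (\sum_z delta z)
    + delta y * ((x \in I)%:R / i) + delta x * ((y \in I)%:R / i)).
  have D3 := @decomposable_join R T p delta.
  apply: decomposable_ext (D3 _ _ _ _ _) => [x y xy|x y|x y|x|x|x y] //.
  - by rewrite !psum.
  - by rewrite /p divr_ge0 ?ler0n // mulr_ge0 // ltW.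
  - by rewrite /p andbCA eq_sym.
  - by rewrite /p eqxx !andbF mul0r.
  - case: (boolP (x \in J)) => [/JI xI|/negPf xJ]; first by rewrite /p xI !mul0r.
    by rewrite /delta xJ mul0r mulr0.
have k0 : 0 <= lam - (\sum_x delta x) / (i * (i - 1)).
  by rewrite subr_ge0 ler_pdivrMr ?mulr_gt0 // mulrC.
have dec4 := decomposableZ k0 (decomposable_clique R I3).
have li : 0 <= lam^-1 by rewrite invr_ge0 ltW.
have dec := decomposableZ li (decomposableD (decomposableD dec1 dec2) (decomposableD dec3 dec4)).
apply: decomposable_ext dec => x y xy.
apply: (@mulfI _ lam); first by rewrite gt_eqF.
rewrite mulVKf ?gt_eqF // /demand.
have Y0 z : z \notin J -> Y z = 0 by move=> zJ; rewrite /Y big1 // => t _; rewrite rho'J.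
have out z : z \notin A -> z \notin I /\ z \notin J.
  by move=> zA; rewrite inE (negPf zA) andbF; split=> //; apply: contra zA => /(subsetP IA).
case: (boolP (x \in A)) => xA; last first.
  have [/negPf xI xJ] := out x xA.
  by rewrite (rho'J x) // (rhoJ x) // /delta /p xI (negPf xJ) (Y0 x) //=; ring.
case: (boolP (y \in A)) => yA; last first.
  have [/negPf yI yJ] := out y yA.
  rewrite (rhos x) (rho's x) (rho'J y) // (rhoJ y) // /delta /p yI (negPf yJ) (Y0 y) //.
  by rewrite /= ?andbF /=; ring.
have JE z : z \in A -> (z \in J) = (z \notin I) by move=> zA; rewrite inE zA andbT.
have i10 : i - 1 != 0 by rewrite gt_eqF.
have i00 : i != 0 by rewrite gt_eqF.
have [xI|xI] := boolP (x \in I); have [yI|yI] := boolP (y \in I).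
- have [xJ yJ] : x \notin J /\ y \notin J by rewrite !JE // xI yI.
  rewrite (rho'J x) // (rhoJ x) // !Y0 // /delta /p xI yI xy (negPf xJ) (negPf yJ) hI //=.
  by field; rewrite i10.
- have [xJ yJ] : x \notin J /\ y \in J by rewrite !JE // xI yI.
  rewrite (rho'J x) // (rhoJ x) // (Y0 x) // /delta /p xI (negPf yI) (negPf xJ) yJ hI //=.
  by field; rewrite ?i10 ?i00.
- have [xJ yJ] : x \in J /\ y \notin J by rewrite !JE // xI yI.
  rewrite rhos rho's (rho'J y) // (rhoJ y) // (Y0 y) // /delta /p yI (negPf xI) (negPf yJ).
  rewrite xJ h_sym hI //=.
  by field; rewrite ?i10 ?i00.
have [xJ yJ] : x \in J /\ y \in J by rewrite !JE // xI yI.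
by rewrite /rho' /g /delta /p xJ yJ xy (negPf xI) (negPf yI) DJ //=; ring.
Qed.

Lemma sum_isolated : (\sum_(x in J) (degree h A x)%:R : R) = (missing h A)%:R.
Proof.
rewrite -natr_sum; congr _%:R.
by rewrite /missing [RHS](big_setID I) /= (setIidPr IA) [X in _ = (X + _)%N]big1.
Qed.

(** With [D = 0], the first inequality of [decomposable_balance] says that a vertex
    of [J] is joined to at most [#|I|] others in [J].  The second one reduces to
    [i ^ 2 + j ^ 2 - i * j - 3 * (i + j) + 8 >= 0], whose left side is
    [(n - 4) * (n - 8) / 4 + 3 * (i - j) ^ 2 / 4] with [n = i + j]. *)
Lemma decomposable_many_isolated :
  (8 <= #|A|)%N -> (missing h A + 8 <= 2 * #|A|)%N -> (3 <= #|I|)%N ->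
  {in J, forall u, 0 < degree h A u}%N -> (#|J| <= #|I| + 2)%N ->
  decomposable (graph A).
Proof.
move=> A8 mA I3 Jdeg JI2.
have cA : (#|J| + #|I| = #|A|)%N by rewrite cardsD (setIidPr IA) subnK // subset_leq_card.
apply: (@decomposable_balance (fun _ _ => 0) 0 1) => //.
- exact: decomposable0.
- by move=> x y _ _ _; rewrite mul0r.
- move=> x xJ; rewrite big1 // add0r subr0 mul1r mulr1.
  have : (#|J| <= #|I| + 1 + degree h A x)%N by have := Jdeg x xJ; lia.
  by rewrite -(ler_nat R) 2!natrD; lra.
rewrite [X in _ + X]big1 ?addr0 => [|v _]; last by rewrite big1.
have mR : (missing h A)%:R + 8 <= 2 * (#|J|%:R + i).
  by move: mA; rewrite -cA -(ler_nat R) natrD natrM natrD.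
have nR : 8 <= #|J|%:R + i by move: A8; rewrite -cA -(ler_nat R) natrD.
rewrite (eq_bigr (fun x => (i - #|J|%:R + 1) + (degree h A x)%:R)); last first.
  by move=> x _; rewrite big1 //; ring.
rewrite big_split /= sum_isolated sumr_const -[X in X + _]mulr_natr mulr1.
move: mR nR; move: (#|J|%:R) (i) ((missing h A)%:R) => b a m mR nR.
have p1 : 0 <= (a - b) ^+ 2 by apply: sqr_ge0.
have p2 : 0 <= (a + b - 4) * (a + b - 8) by rewrite mulr_ge0 //; lra.
by nra.
Qed.

End Balance.

(** * The slack of a dominant hub *)
Section Rates.
Variable R : realFieldType.
Implicit Types i m b c : R.

(** Used with [i = #|I|] and [m = #|J| - 2].  The slacks sum to [2 * i + m - 6] and none
    exceeds [(m + i - 1) / 3], so the last hypothesis holds as soon as the slacks, capped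
    at [i], sum to less than [m]. *)
Lemma many_nonisolated i m : 3 <= i -> 0 <= m ->
  (2 * i + m - 6) * (3 * i) < m * (m + i - 1) -> 3 * (i - 2) <= m.
Proof.
move=> i3 m0 lt; rewrite leNgt; apply/negP => mi.
have h1 : 0 <= m * (3 * (i - 2) - m) by rewrite mulr_ge0 //; lra.
have h2 : 0 <= i * (i - 3) by rewrite mulr_ge0 //; lra.
have [i7|i7] := lerP i 7.
  have h3 : 0 <= m * (7 - i) by rewrite mulr_ge0 //; lra.
  by lra.
have h3 : 0 <= (3 * (i - 2) - m) * (i - 7) by rewrite mulr_ge0 //; lra.
by lra.
Qed.

(** With [i] and [m] as before, [b] is the slack of the hub and [W] that of the other
    vertices.  The hub deletes vertices of [I] at the rate [t] per unit of its slack,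
    the others at the rate [t + r].  Their surplus, [rho] in total, has to be
    compensated by the hub in the fraction [1 - b / m] of its summand in which [I] is
    kept, and the last inequality says that its slack is sufficient.  The slack of a
    vertex is a number [c] with [3 * c + 1 <= i + m], and by the fourth conclusion it
    deletes at most [i] vertices. *)
Lemma dominant_hub_rates i m b : 3 <= i -> i + 1 <= b -> 3 * b + 1 <= i + m ->
  3 * (i - 2) <= m ->
  let t := i / m in let W := 2 * i + m - 6 - b in
  let rho := i - 3 * t * (i - 2) in let r := rho / W in
  [/\ 0 < W, 0 <= r, t + r <= 1, forall c, 3 * c + 1 <= i + m -> (t + r) * c <= i
    & rho <= b * (1 - b / m)].
Proof.
move=> i3 bi b3 mi t W rho r.
have m_ge : 2 * i + 4 <= m by lra.
have m0 : 0 < m by lra.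
have i0 : 0 < i by lra.
have W0 : 0 < W by rewrite /W; lra.
have t0 : 0 < t by rewrite divr_gt0.
have rhoE : rho = i * (m - 3 * (i - 2)) / m by rewrite /rho /t; field; rewrite gt_eqF.
have rho0 : 0 <= rho.
  by rewrite rhoE divr_ge0 ?(ltW m0) // mulr_ge0 ?(ltW i0) // subr_ge0.
have r0 : 0 <= r by rewrite divr_ge0 // ltW.
have W3 : 5 * i + 2 * m - 17 <= 3 * W by rewrite /W; lra.
have trE : t + r = i * (W + m - 3 * (i - 2)) / (m * W).
  by rewrite /r rhoE /t; field; rewrite !gt_eqF.
have mm : 0 <= m * (m - 10) by rewrite mulr_ge0 //; lra.
have im : 0 <= (i - 3) * m by rewrite mulr_ge0 //; lra.
have ii : 0 <= i * (i - 3) by rewrite mulr_ge0 //; lra.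
split=> // [|c c3|].
- rewrite trE ler_pdivrMr ?mulr_gt0 // mul1r.
  have h1 : 0 <= (m - i) * (3 * W - (5 * i + 2 * m - 17)) by rewrite mulr_ge0 //; lra.
  by lra.
- have tr3 : (t + r) * (i + m - 1) <= i * 3.
    rewrite trE mulrAC ler_pdivrMr ?mulr_gt0 // -!mulrA ler_wpM2l ?(ltW i0) //.
    have h1 : 0 <= (2 * m - i + 1) * (3 * W - (5 * i + 2 * m - 17)).
      by rewrite mulr_ge0 //; lra.
    by lra.
  have : (t + r) * (3 * c) <= (t + r) * (i + m - 1).
    by rewrite ler_wpM2l ?addr_ge0 // ?(ltW t0) //; lra.
  by lra.
rewrite rhoE ler_pdivrMr //.
have -> : b * (1 - b / m) * m = b * (m - b) by field; rewrite gt_eqF.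
have h1 : 0 <= (b - i) * (m - i - b) by rewrite mulr_ge0 //; lra.
by lra.
Qed.

End Rates.

(** * Spending the slack when [3 <= #|I| <= #|J| - 3] *)
Section SomeIsolated.
Variables (R : realFieldType) (T : finType) (h : rel T) (A I : {set T}).
Hypotheses (h_sym : symmetric h) (h_irr : irreflexive h).
Hypothesis smaller : forall B : {set T}, (7 <= #|B| < #|A|)%N -> resilient R B.
Hypotheses (IA : I \subset A) (I_isolated : forall v, v \in I -> degree h A v = 0%N).
Hypothesis tight : (missing h A + 8 = 2 * #|A|)%N.
Hypothesis A10 : (10 <= #|A|)%N.
Hypothesis J_degree : {in A :\: I, forall u, 0 < degree h A u}%N.
Hypothesis small_degree : {in A, forall u, 3 * degree h A u <= #|A|}%N.

Local Notation J := (A :\: I).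
Local Notation i := (#|I|%:R : R).
Local Notation j := (#|J|%:R : R).
Local Notation graph B := (demand B (fun x y => (h x y)%:R : R)).

(** The slack left over by the deletion of [u]. *)
Let a u := (degree h A u).-1.

Let JA u : u \in J -> u \in A. Proof. by rewrite inE => /andP[]. Qed.
Let JI u : u \in J -> u \in I = false. Proof. by rewrite inE => /andP[/negPf]. Qed.
Let aE u : u \in J -> degree h A u = (a u).+1.
Proof. by move=> uJ; have := J_degree uJ; rewrite /a; case: (degree h A u). Qed.
Let hI v y : v \in I -> y \in A -> h v y = false.
Proof. by move=> vI; apply: degree_eq0; apply: I_isolated. Qed.
Let cardJI : (#|J| + #|I| = #|A|)%N.
Proof. by rewrite cardsD (setIidPr IA) subnK // subset_leq_card. Qed.

Let a_small u : u \in J -> (3 * a u + 3 <= #|A|)%N.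
Proof. by move=> uJ; have := small_degree (JA uJ); rewrite aE // mulnS addnC. Qed.

Let sum_a : (\sum_(u in J) a u + 8 = #|A| + #|I|)%N.
Proof.
have : (\sum_(u in J) a u + #|J| = missing h A)%N.
  rewrite -sum1_card -big_split /= /missing [RHS](big_setID I) /= (setIidPr IA).
  rewrite [X in _ = (X + _)%N]big1 // add0n; apply: eq_bigr => u uJ.
  by rewrite aE // addn1.
by move: tight cardJI; clear; lia.
Qed.

(** With probability [p], the slack of [u] deletes as many vertices of [I] as it can;
    otherwise it lowers the pairs between each [x] of [J] and [I] by [q x].  Since at
    most [#|I|] vertices are deleted, each of them accounts for at least [#|I| - 1]
    ordered pairs inside [I], which gives the last bound. *)
Lemma decomposable_partial_deletion u (p : R) (q : T -> R) :
  u \in J -> 0 <= p <= 1 -> (forall x, 0 <= q x <= 1) -> q u = 0 ->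
  i * (\sum_(x in J) q x) <= (a u)%:R ->
  exists d : T -> T -> R,
  [/\ decomposable d,
      {in J &, forall x y, x != y -> d x y = ((u != x) && (u != y))%:R * (1 - (h x y)%:R)},
      forall x y, x \notin A -> d x y = 0,
      forall x, x \in J -> \sum_(v in I) d x v =
        (u != x)%:R * (i - p * (minn #|I| (a u))%:R - (1 - p) * i * q x)
    & \sum_(v in I) \sum_(t in I | t != v) d v t
        <= (i - 1) * (i - p * (minn #|I| (a u))%:R)].
Proof.
move=> uJ /andP[p0 p1] q01 qu qsum; have uA := JA uJ.
pose s := minn #|I| (a u); have sI : (s <= #|I|)%N by rewrite geq_minl.
have [V VI cV] : exists2 V : {set T}, V \subset I & #|V| = s.
  exists [set v in take s (enum I)].
    by apply/subsetP => v; rewrite inE => /mem_take; rewrite mem_enum.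
  by rewrite cardsE (card_uniqP (take_uniq _ (enum_uniq _))) size_takel // -cardE.
pose f x y : R := (x \in J)%:R * (y \in I)%:R * q x + (y \in J)%:R * (x \in I)%:R * q y.
have q0 x : 0 <= q x by case/andP: (q01 x).
have f0 x y : 0 <= f x y by rewrite addr_ge0 // !mulr_ge0.
have fs x y : f x y = f y x by rewrite /f addrC.
have fd x : f x x = 0.
  by rewrite /f; case: (boolP (x \in J)) => [/JI ->|_]; rewrite ?mul0r ?mulr0 ?mul0r addr0.
have f1 x y : (h x y)%:R + f x y <= 1.
  have hf z t : z \in J -> t \in I -> (h z t)%:R + q z <= 1.
    by move=> zJ tI; rewrite h_sym hI ?JA // add0r; case/andP: (q01 z).
  rewrite /f; case: (boolP (x \in J)) => xJ; case: (boolP (y \in J)) => yJ.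
  - by rewrite (JI xJ) (JI yJ) !mulr0 !mul0r !addr0 lern1 leq_b1.
  - case: (boolP (y \in I)) => yI; last by rewrite !mulr0 !mul0r !addr0 lern1 leq_b1.
    by rewrite !mul1r !mul0r addr0 hf.
  - case: (boolP (x \in I)) => xI; last by rewrite !mulr0 !mul0r !addr0 lern1 leq_b1.
    by rewrite !mul1r !mul0r add0r h_sym hf.
  - by rewrite !mul0r !addr0 lern1 leq_b1.
have tf : total_weight (A :\ u :\: set0) f <= 2 * (i * \sum_(x in J) q x).
  have F_le : \sum_(x in A :\ u :\: set0) \sum_(y in A :\ u :\: set0)
      (x \in J)%:R * (y \in I)%:R * q x <= i * \sum_(x in J) q x.
    rewrite mulr_sumr big_mkcond [leRHS]big_mkcond; apply: ler_sum => x _.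
    case: (boolP (x \in J)) => xJ; last first.
      by case: ifP => // _; rewrite big1 // => y _; rewrite !mul0r.
    case: ifP => _; last by rewrite mulr_ge0.
    under eq_bigr do rewrite mul1r.
    rewrite -mulr_suml ler_wpM2r // -natr_sum ler_nat -sum1_card big_mkcond.
    by rewrite [leqRHS]big_mkcond; apply: leq_sum => y _; case: ifP => //; case: (y \in I).
  rewrite /total_weight /f; under eq_bigr do rewrite big_split /=.
  by rewrite big_split /= [X in _ + X]exchange_big /=; lra.
have few : (missing h A + 8 <= 2 * #|A|)%N by rewrite tight.
have dec1 : decomposable (demand (A :\ u :\: set0) (fun x y => (h x y)%:R + f x y)).
  apply: (decomposable_delete h_sym h_irr smaller few) => //.
  - exact: sub0set.
  - by rewrite cards0 addn0 (leq_trans _ A10).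
  by rewrite cards0 aE // -natr1; lra.
have dec2 : decomposable (demand (A :\ u :\: V) (fun x y => (h x y)%:R + 0 : R)).
  apply: (decomposable_delete (f := fun _ _ => 0) h_sym h_irr smaller few) => //.
  - apply: subset_trans VI _; apply/subsetP => v vI; rewrite !inE (subsetP IA) // andbT.
    by apply: contraTneq uJ => <-; rewrite inE vI.
  - have := a_small uJ; have := geq_minr #|I| (a u); rewrite cV -/s; move: A10.
    by clear; lia.
  - by move=> x y; rewrite addr0 lern1 leq_b1.
  rewrite /total_weight big1 ?addr0 => [|x _]; last by rewrite big1.
  have : (s <= a u)%N by rewrite geq_minr.
  by rewrite cV aE // -natr1 -(ler_nat R); lra.
exists (fun x y => (1 - p) * demand (A :\ u :\: set0) (fun x y => (h x y)%:R + f x y) x y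
                  + p * demand (A :\ u :\: V) (fun x y => (h x y)%:R + 0 : R) x y).
have inV x : x \in J -> x \in V = false.
  by move=> xJ; apply: contraFF (JI xJ) => /(subsetP VI).
have inB x : x \in J -> (x \in A :\ u :\: set0 = (u != x)) * (x \in A :\ u :\: V = (u != x)).
  by move=> xJ; rewrite !inE inV // JA // andbT eq_sym.
have inBI v : v \in I -> (v \in A :\ u :\: set0) * (v \in A :\ u :\: V = (v \notin V)).
  move=> vI; have vu : v != u by apply: contraTneq uJ => <-; rewrite inE vI.
  by rewrite !inE (subsetP IA) // vu !andbT.
have fII v t : v \in I -> t \in I -> f v t = 0.
  by move=> vI tI; rewrite /f !in_setD vI tI /= !mul0r addr0.
have cVI : \sum_(v in I) (v \notin V)%:R = i - s%:R :> R.
  rewrite -cV -[in RHS](setIidPr VI) -natrB ?subset_leq_card ?subsetIl // -cardsD.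
  rewrite -natr_sum -sum1_card big_mkcond [in RHS]big_mkcond; congr _%:R.
  by apply: eq_bigr => v _; rewrite inE; case: (v \in I) (v \in V) => [] [].
split.
- apply: decomposableD; apply: decomposableZ => //; lra.
- move=> x y xJ yJ xy; rewrite /demand !inB // /f (JI xJ) (JI yJ) -natrM mulnb.
  by rewrite !mulr0 !mul0r !addr0; ring.
- move=> x y xA; rewrite /demand.
  rewrite [x \in _]inE [x \in A :\ u]inE (negPf xA) !andbF.
  by rewrite [x \in A :\ u :\: V]inE [x \in A :\ u]inE (negPf xA) !andbF !mul0r !mulr0 addr0.
- move=> x xJ; rewrite (eq_bigr (fun v =>
      (u != x)%:R * ((1 - p) * (1 - q x) + p * (v \notin V)%:R))).
    by rewrite -mulr_sumr big_split /= sumr_const -!mulr_sumr cVI -mulr_natl; ring.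
  move=> v vI; rewrite /demand !(inB _ xJ) !(inBI _ vI) /f xJ vI h_sym hI ?JA //.
  by rewrite in_setD vI /=; ring.
rewrite (eq_bigr (fun v => (1 - p) * (i - 1) + p * ((v \notin V)%:R * (i - s%:R - 1)))).
  rewrite big_split /= sumr_const -!mulr_sumr -mulr_suml cVI -mulr_natl -/s.
  have siR : s%:R <= i by rewrite ler_nat.
  have s0 : 0 <= s%:R :> R by rewrite ler0n.
  have := mulr_ge0 p0 (mulr_ge0 s0 (_ : 0 <= i - s%:R)); rewrite subr_ge0 => /(_ siR); nra.
move=> v vI; rewrite (eq_bigr (fun t => (1 - p) + p * ((v \notin V)%:R * (t \notin V)%:R))).
  have off (F : T -> R) : \sum_(t in I | t != v) F t = \sum_(t in I) F t - F v.
    by rewrite [X in _ = X - _](bigD1 v) //= addrAC subrr add0r.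
  rewrite off big_split /= sumr_const -!mulr_sumr cVI -[(1 - p) *+ _]mulr_natl.
  by case: (v \in V) => /=; ring.
move=> t /andP[tI tv]; rewrite /demand !(inBI _ vI) !(inBI _ tI) hI ?(subsetP IA) // fII //=; ring.
Qed.

(** The demand is the sum over [u] of the [d u], where [sigma u] is the number of
    vertices of [I] deleted with [u] and [r u x] the amount by which the pairs
    between [x] and [I] are lowered.  It covers pairs inside [J] [#|J| - 2] times, and
    [t] is the amount by which [decomposable_balance] raises this.  The equation for
    the total of [sigma] makes [J] and [I] fit exactly at a vertex of [J] that has slack 0
    and whose pairs are not lowered. *)
Lemma decomposable_scheme (d : T -> T -> T -> R) (sigma : T -> R) (r : T -> T -> R) (t : R) :
  (3 <= #|I|)%N -> (3 <= #|J|)%N -> 0 <= t ->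
  (forall u, u \in J -> [/\ decomposable (d u),
     {in J &, forall x y, x != y -> d u x y = ((u != x) && (u != y))%:R * (1 - (h x y)%:R)},
     forall x y, x \notin A -> d u x y = 0,
     forall x, x \in J -> \sum_(v in I) d u x v = (u != x)%:R * (i - sigma u - r u x)
   & \sum_(v in I) \sum_(s in I | s != v) d u v s <= (i - 1) * (i - sigma u)]) ->
  \sum_(u in J) sigma u = i + t * (j - 2 - i) ->
  (forall x, x \in J -> sigma x <= t * (a x)%:R + \sum_(u in J | u != x) r u x) ->
  \sum_(x in J) (t * (a x)%:R + \sum_(u in J | u != x) r u x - sigma x)
    + i * (i - 1) * (2 - t) <= (i - 1) * \sum_(u in J) sigma u ->
  decomposable (graph A).
Proof.
move=> I3 J3 t0 dP S_eq sigma_le total_le.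
have j3 : 3 <= j by rewrite (ler_nat R 3).
have Xsum x : x \in J -> \sum_(v in I) \sum_(u in J) d u x v =
    (j - 1) * i - \sum_(u in J) sigma u + sigma x - \sum_(u in J | u != x) r u x.
  move=> xJ; rewrite exchange_big /=.
  rewrite (eq_bigr (fun u => if u != x then i - sigma u - r u x else 0)); last first.
    by move=> u uJ; have [_ _ _ -> // _] := dP u uJ; case: (u != x); rewrite ?mul1r ?mul0r.
  rewrite -big_mkcondr /= !sumrB [in RHS](bigD1 x) //=.
  rewrite [X in X - _ - _](_ : _ = (j - 1) * i); first by ring.
  rewrite (eq_bigl (fun u => u \in J :\ x)) => [|u]; last by rewrite in_setD1 andbC.
  rewrite sumr_const -[LHS]mulr_natl; congr (_ * _).
  by rewrite (cardsD1 x J) xJ add1n -natr1 addrK.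
apply: (@decomposable_balance R T h A I h_sym h_irr IA I_isolated
   (fun x y => \sum_(u in J) d u x y) (j - 2) (j - 2 + t)) => //.
- by apply: decomposable_sum => u /dP[].
- lra.
- lra.
- move=> x y xJ yJ xy; rewrite (eq_bigr (fun u =>
      if (u != x) && (u != y) then 1 - (h x y)%:R else 0)).
    rewrite -big_mkcondr (eq_bigl (fun u => u \in J :\ x :\ y)); last first.
      by move=> u; rewrite !in_setD1; case: (u \in J) (u == x) (u == y) => [] [] [].
    rewrite sumr_const -[LHS]mulr_natl; congr (_ * _).
    have yJx : y \in J :\ x by rewrite in_setD1 eq_sym xy.
    by rewrite (cardsD1 x J) xJ (cardsD1 y (J :\ x)) yJx !natrD /=; ring.
  by move=> u uJ; have [_ -> // _ _ _] := dP u uJ; case: ifP => _; rewrite ?mul1r ?mul0r.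
- move=> x y _ xA; rewrite big1 // => u uJ; by have [_ _ -> // _ _] := dP u uJ.
- move=> x xJ; rewrite Xsum // aE // -natr1 S_eq.
  by have := sigma_le x xJ; lra.
rewrite (eq_bigr (fun x => t * (a x)%:R + \sum_(u in J | u != x) r u x - sigma x)); last first.
  by move=> x xJ; rewrite Xsum // aE // -natr1 S_eq; ring.
have : \sum_(v in I) \sum_(s in I | s != v) \sum_(u in J) d u v s <=
    (i - 1) * (j * i - \sum_(u in J) sigma u).
  under eq_bigr => v _ do rewrite exchange_big /=.
  rewrite exchange_big /= mulrBr.
  apply: (@le_trans _ _ (\sum_(u in J) (i - 1) * (i - sigma u))).
    by apply: ler_sum => u uJ; have [_ _ _ _] := dP u uJ.
  by rewrite -mulr_sumr -mulrBr sumrB sumr_const mulr_natl.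
move: total_le; lra.
Qed.

Local Notation s u := ((minn #|I| (a u))%:R : R).

Lemma decomposable_mixture (p : T -> R) (q : T -> T -> R) (t : R) :
  (3 <= #|I|)%N -> (3 <= #|J|)%N -> 0 <= t ->
  (forall u, u \in J -> 0 <= p u <= 1) -> (forall u x, 0 <= q u x <= 1) ->
  (forall u, q u u = 0) -> (forall u, u \in J -> i * (\sum_(x in J) q u x) <= (a u)%:R) ->
  \sum_(u in J) p u * s u = i + t * (j - 2 - i) ->
  (forall x, x \in J ->
     p x * s x <= t * (a x)%:R + \sum_(u in J | u != x) (1 - p u) * i * q u x) ->
  \sum_(x in J) (t * (a x)%:R + \sum_(u in J | u != x) (1 - p u) * i * q u x - p x * s x)
    + i * (i - 1) * (2 - t) <= (i - 1) * \sum_(u in J) p u * s u ->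
  decomposable (graph A).
Proof.
move=> I3 J3 t0 p01 q01 qd qa S_eq le total_le.
have /fin_all_exists[d dP] : forall u, exists d : T -> T -> R, u \in J ->
  [/\ decomposable d,
      {in J &, forall x y, x != y -> d x y = ((u != x) && (u != y))%:R * (1 - (h x y)%:R)},
      forall x y, x \notin A -> d x y = 0,
      forall x, x \in J -> \sum_(v in I) d x v =
        (u != x)%:R * (i - p u * s u - (1 - p u) * i * q u x)
    & \sum_(v in I) \sum_(t in I | t != v) d v t <= (i - 1) * (i - p u * s u)].
  move=> u; case: (boolP (u \in J)) => uJ; last by exists (fun _ _ => 0).
  have [d dP] := decomposable_partial_deletion uJ (p01 u uJ) (q01 u) (qd u) (qa u uJ).
  by exists d.
exact: (@decomposable_scheme d (fun u => p u * s u) (fun u x => (1 - p u) * i * q u x) t).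
Qed.

Let sum_aR : \sum_(u in J) (a u)%:R = 2 * i + j - 8.
Proof.
rewrite -natr_sum; have : (\sum_(u in J) a u + 8 = 2 * #|I| + #|J|)%N.
  by move: sum_a cardJI; clear; lia.
by move=> /(congr1 (fun k => k%:R : R)); rewrite 2!natrD natrM => <-; rewrite addrK.
Qed.

Let a_smallR u : u \in J -> 3 * (a u)%:R + 3 <= i + j.
Proof. by move/a_small; rewrite -cardJI -(ler_nat R) natrD natrM natrD (addrC i). Qed.

(** Everything is deleted that the slack allows, and [t] is determined by the total
    number of deletions.  The hypothesis says [t >= 1], so no vertex deletes more than
    [t] times its slack. *)
Lemma decomposable_full_deletion : (3 <= #|I|)%N -> (#|I| + 3 <= #|J|)%N ->
  (#|J| <= \sum_(u in J) minn #|I| (a u) + 2)%N -> decomposable (graph A).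
Proof.
move=> I3 IJ JM.
have i3 : 3 <= i by rewrite (ler_nat R 3).
have ij : i + 3 <= j by rewrite -(natrD _ _ 3) ler_nat.
have jM : j - 2 <= \sum_(u in J) s u.
  by rewrite -natr_sum lerBlDr -(natrD _ _ 2) ler_nat.
pose t : R := ((\sum_(u in J) s u) - i) / (j - 2 - i).
have dpos : 0 < j - 2 - i by lra.
have t1 : 1 <= t by rewrite ler_pdivlMr // mul1r; lra.
have ME : \sum_(u in J) s u = i + t * (j - 2 - i).
  by rewrite /t divfK ?gt_eqF //; ring.
have no_r x : \sum_(u in J | u != x) (1 - 1) * i * 0 = 0 :> R.
  by rewrite big1 // => u _; rewrite mulr0.
have Mp : \sum_(u in J) 1 * s u = \sum_(u in J) s u.
  by apply: eq_bigr => u _; rewrite mul1r.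
apply: (@decomposable_mixture (fun=> 1) (fun _ _ => 0) t) => //.
- lia.
- lra.
- by move=> u _; rewrite ler01 lexx.
- by move=> u x; rewrite lexx ler01.
- by move=> u _; rewrite big1 // mulr0 ler0n.
- by rewrite Mp.
- move=> x xJ; rewrite no_r addr0 mul1r; apply: (@le_trans _ _ (a x)%:R).
    by rewrite ler_nat geq_minr.
  by rewrite ler_peMl ?ler0n.
rewrite Mp (eq_bigr (fun x => t * (a x)%:R - s x)); last first.
  by move=> x _; rewrite no_r addr0 mul1r.
rewrite sumrB -mulr_sumr sum_aR.
suff key : i * (i - 2) <= t * ((i - 1) * (j - 2) - 3 * (i - 2)) by rewrite ME; lra.
have [j4|j3] := leqP (#|I| + 4) #|J|.
  have ij4 : i + 4 <= j by rewrite -(natrD _ _ 4) ler_nat.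
  have c1 : i * (i - 2) <= (i - 1) * (j - 2) - 3 * (i - 2) by nra.
  apply: le_trans c1 _; rewrite ler_peMl //; nra.
have jE : j = i + 3 by rewrite -(natrD _ _ 3); congr _%:R; lia.
have tE : t = 2 * i - 5.
  rewrite /t (eq_bigr (fun u => (a u)%:R)) => [|u uJ].
    by rewrite sum_aR jE; field; rewrite gt_eqF //; lra.
  have := a_smallR uJ; rewrite jE => au; congr _%:R; apply/minn_idPr.
  rewrite -(ler_nat R); lra.
have y0 : 0 <= i - 3 by lra.
rewrite tE jE -subr_ge0.
rewrite [leRHS](_ : _ = 2 * (i - 3) ^+ 3 + 6 * (i - 3) ^+ 2 + 9 * (i - 3) + 2); last by ring.
by rewrite !addr_ge0 ?mulr_ge0 ?exprn_ge0.
Qed.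

(** If the slacks capped at [#|I|] add up to less than [#|J| - 2], some hub [B] has
    more slack than there are vertices in [I], and the part beyond [#|I|] buys no
    deletions.  So [B] deletes all of [I] only with probability [a B / (#|J| - 2)], and
    otherwise lowers the pairs between [I] and the other vertices [x] of [J] by
    amounts proportional to [a x].  This lets every [x] delete vertices of [I] at the
    rate [t + r] instead of [t], and both inequalities of [decomposable_scheme] hold
    with [t = #|I| / (#|J| - 2)], the first one as an equation for every [x]. *)
Lemma decomposable_dominant_hub : (3 <= #|I|)%N ->
  (\sum_(u in J) minn #|I| (a u) + 2 < #|J|)%N -> decomposable (graph A).
Proof.
move=> I3 MJ.
have i3 : 3 <= i by rewrite (ler_nat R 3).
have [B BJ aB] : exists2 u, u \in J & (#|I| < a u)%N.
  apply/exists_inP; apply: contraT => /exists_inPn no.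
  have : (\sum_(u in J) minn #|I| (a u) = \sum_(u in J) a u)%N.
    by apply: eq_bigr => u uJ; apply/minn_idPr; rewrite leqNgt no.
  by move: sum_a cardJI MJ I3; clear; lia.
pose m : R := j - 2; pose b : R := (a B)%:R.
have bi : i + 1 <= b by rewrite natr1 ler_nat.
have b3 : 3 * b + 1 <= i + m by have := a_smallR BJ; rewrite /m -/b; lra.
have m_ge : 2 * i + 4 <= m by lra.
have s0 u : 0 <= s u by rewrite ler0n.
have sE u : u \in J -> (a u)%:R * (3 * i) <= s u * (m + i - 1).
  move=> uJ; have a0 : 0 <= (a u)%:R :> R by rewrite ler0n.
  have := a_smallR uJ; case: (leqP #|I| (a u)) => [_|_] a3.
    suff : i * (3 * (a u)%:R) <= i * (m + i - 1) by lra.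
    by rewrite ler_wpM2l ?ler0n // /m; lra.
  by rewrite ler_wpM2l //; lra.
have Mm : \sum_(u in J) s u < m.
  by move: MJ; rewrite /m ltrBrDr -natr_sum -natrD ltr_nat.
have sigma_lt : (2 * i + m - 6) * (3 * i) < m * (m + i - 1).
  have -> : 2 * i + m - 6 = \sum_(u in J) (a u)%:R by rewrite sum_aR /m; ring.
  rewrite mulr_suml; apply: (@le_lt_trans _ _ ((\sum_(u in J) s u) * (m + i - 1))).
    by rewrite mulr_suml; apply: ler_sum => u uJ; apply: sE.
  by rewrite ltr_pM2r //; lra.
have m_ge3 : 3 * (i - 2) <= m by apply: many_nonisolated sigma_lt; lra.
have m0 : 0 < m by lra.
have i0 : 0 < i by lra.
pose t : R := i / m; pose rho := i - 3 * t * (i - 2).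
pose W := 2 * i + m - 6 - b; pose r := rho / W; pose pB := b / m.
have [W0 r0 tr1 tri rho_b] : [/\ 0 < W, 0 <= r, t + r <= 1,
    forall c, 3 * c + 1 <= i + m -> (t + r) * c <= i & rho <= b * (1 - pB)].
  exact: dominant_hub_rates i3 bi b3 m_ge3.
have t0 : 0 < t by rewrite divr_gt0.
have tr0 : 0 <= t + r by rewrite addr_ge0 // ltW.
have rW : r * W = rho by rewrite /r divfK // gt_eqF.
have a3 x : x \in J -> 3 * (a x)%:R + 1 <= i + m.
  by move/a_smallR; rewrite /m; lra.
have pB1 : pB < 1 by rewrite ltr_pdivrMr // mul1r; lra.
have pB0 : 0 <= pB by rewrite divr_ge0 ?ler0n // ltW.
have pB1' : 0 < 1 - pB by rewrite subr_gt0.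
pose p u := if u == B then pB else (t + r) * (a u)%:R / s u.
pose q u x := if (u == B) && (x \in J :\ B) then r * (a x)%:R / ((1 - pB) * i) else 0.
have sB : s B = i by congr _%:R; apply/minn_idPl; rewrite ltnW.
have psB : p B * s B = t * b by rewrite /p eqxx sB /pB /t; field; rewrite gt_eqF.
have ps u : u != B -> p u * s u = (t + r) * (a u)%:R.
  move=> /negPf uB; rewrite /p uB; have [au|au] := posnP (a u).
    by rewrite au minn0 !mulr0.
  by rewrite divfK // pnatr_eq0 -lt0n leq_min au andbT -(ltr_nat R).
have rsum x : x \in J -> \sum_(u in J | u != x) (1 - p u) * i * q u x
    = (x != B)%:R * (r * (a x)%:R).
  move=> xJ; have [->|xB] := eqVneq x B.
    rewrite mul0r big1 // => u /andP[_ /negPf uB].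
    by rewrite /q uB mulr0.
  rewrite (bigD1 B) /=; last by rewrite BJ eq_sym.
  rewrite big1 ?addr0 => [|u /andP[_ /negPf uB]]; last by rewrite /q uB mulr0.
  rewrite /q eqxx in_setD1 xB xJ /p eqxx /=; field.
  by rewrite gt_eqF //= gt_eqF.
have sum_out (F : R) : \sum_(u in J | u != B) F * (a u)%:R = F * W.
  rewrite -mulr_sumr; congr (_ * _); have := sum_aR; rewrite (bigD1 B) //= -/b /W /m; lra.
have psum : \sum_(u in J) p u * s u = t * b + (t + r) * W.
  rewrite (bigD1 B) //= psB -sum_out; congr (_ + _); apply: eq_bigr => u /andP[_ uB].
  exact: ps.
have pS : \sum_(u in J) p u * s u = i + t * (j - 2 - i).
  rewrite psum mulrDl rW /W /rho -/m; ring.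
apply: (@decomposable_mixture p q t) => //.
- by move: MJ cardJI A10 I3 aB; clear; lia.
- exact: ltW.
- move=> u uJ; rewrite /p; case: eqP => [_|/eqP uB]; first by rewrite pB0 ltW.
  rewrite divr_ge0 ?mulr_ge0 ?ler0n //=.
  have [au|au] := posnP (a u); first by rewrite au mulr0 mul0r ler01.
  rewrite ler_pdivrMr ?mul1r; last by rewrite ltr0n leq_min au andbT -(ltr_nat R).
  case: (leqP #|I| (a u)) => _; first exact/tri/a3.
  by rewrite ler_piMl ?ler0n.
- move=> u x; rewrite /q; case: ifP; last by rewrite lexx ler01.
  case/andP=> _; rewrite in_setD1 => /andP[xB xJ].
  have -> : 0 <= r * (a x)%:R / ((1 - pB) * i).
    by rewrite mulr_ge0 ?invr_ge0 ?(mulr_ge0 r0) ?(mulr_ge0 (ltW pB1')).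
  rewrite /= ler_pdivrMr ?mulr_gt0 // mul1r.
  have h1 := tri _ b3; have h2 := tri _ (a3 x xJ).
  have pBi : pB * i = t * b by rewrite /pB /t; field; rewrite gt_eqF.
  have [ab|ba] := lerP (a x)%:R b.
    have : r * (a x)%:R <= r * b by rewrite ler_wpM2l.
    by rewrite mulrBl mul1r pBi; move: h1; lra.
  have : t * b <= t * (a x)%:R by rewrite ler_wpM2l ?ltW.
  by rewrite mulrBl mul1r pBi; move: h2; lra.
- by move=> u; rewrite /q in_setD1; case: eqP => [->|]; rewrite ?eqxx.
- move=> u uJ; rewrite /q; have [->|uB] := eqVneq u B; last by rewrite big1 // mulr0 ler0n.
  rewrite (bigD1 B) //= in_setD1 eqxx /= add0r.
  rewrite (eq_bigr (fun x => r / ((1 - pB) * i) * (a x)%:R)); last first.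
    by move=> x /andP[xJ xB]; rewrite in_setD1 xB xJ mulrAC.
  rewrite sum_out mulrAC rW -/b [leLHS](_ : _ = rho / (1 - pB)); last first.
    by field; rewrite !gt_eqF.
  by rewrite ler_pdivrMr.
- move=> x xJ; rewrite rsum //; have [->|xB] := eqVneq x B.
    by rewrite psB mul0r addr0.
  by rewrite ps // mul1r mulrDl.
rewrite big1 ?add0r; last first.
  move=> x xJ; rewrite rsum //; have [->|xB] := eqVneq x B; first by rewrite psB mul0r addr0 subrr.
  by rewrite ps // mul1r; ring.
rewrite pS -/m.
have tm : t * m = i by rewrite /t divfK // gt_eqF.
rewrite (_ : i + t * (m - i) = i * (2 - t)); last by lra.
by rewrite mulrCA mulrA.
Qed.

End SomeIsolated.

(** * Seven, eight and nine vertices *)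
Notation edge_list := (seq (nat * nat)).
Notation weighted_triangles := (seq (nat * nat * nat * nat)).

(** An entry [(F, W)] consists of the missing pairs of a graph on the vertices
    [0, 1, ...] and of triangles [(p, q, t, w)] of weight [w / 6] that decompose the
    graph.  The weights are solutions of the linear program that defines fractional
    triangle decompositions; all of them turn out to be multiples of 1/6.  The graphs
    have at most 3 missing pairs on seven vertices, 4 on eight and 5 on nine. *)
Definition catalogue7 : seq (edge_list * weighted_triangles) := [::
  ([::],
   [:: (0,1,2,6); (0,3,5,6); (0,4,6,6); (1,3,6,6); (1,4,5,6); (2,3,4,6); (2,5,6,6)]);
  ([:: (0,1)],
   [:: (0,2,5,2); (0,2,6,4); (0,3,4,3); (0,3,5,1); (0,3,6,2); (0,4,5,3); (1,2,3,4);
    (1,2,5,2); (1,3,4,1); (1,3,5,1); (1,4,5,1); (1,4,6,4); (1,5,6,2); (2,3,4,2);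
    (2,4,5,2); (2,4,6,2); (3,5,6,4)]);
  ([:: (0,1); (0,2)],
   [:: (0,3,4,1); (0,3,6,5); (0,4,5,5); (0,5,6,1); (1,2,3,2); (1,2,4,1); (1,2,5,2);
    (1,2,6,1); (1,3,5,4); (1,4,6,5); (2,3,4,4); (2,4,6,1); (2,5,6,4); (3,4,5,1);
    (3,5,6,1)]);
  ([:: (0,1); (2,3)],
   [:: (0,2,4,2); (0,2,5,4); (0,3,4,3); (0,3,6,3); (0,4,6,1); (0,5,6,2); (1,2,4,1);
    (1,2,6,5); (1,3,4,2); (1,3,5,4); (1,4,5,2); (1,4,6,1); (2,4,5,2); (2,4,6,1);
    (3,4,6,1); (3,5,6,2); (4,5,6,2)]);
  ([:: (0,1); (0,2); (0,3)],
   [:: (0,4,5,3); (0,4,6,3); (0,5,6,3); (1,2,4,3); (1,2,6,3); (1,3,4,3); (1,3,5,3);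
    (1,5,6,3); (2,3,5,3); (2,3,6,3); (2,4,5,3); (3,4,6,3)]);
  ([:: (0,1); (0,2); (1,2)],
   [:: (0,3,6,6); (0,4,5,6); (1,3,4,6); (1,5,6,6); (2,3,5,6); (2,4,6,6)]);
  ([:: (0,1); (0,2); (1,3)],
   [:: (0,3,5,3); (0,3,6,3); (0,4,5,3); (0,4,6,3); (1,2,5,3); (1,2,6,3); (1,4,5,3);
    (1,4,6,3); (2,3,4,6); (2,5,6,3); (3,5,6,3)]);
  ([:: (0,1); (0,2); (3,4)],
   [:: (0,3,5,6); (0,4,6,6); (1,2,3,3); (1,2,4,3); (1,3,6,3); (1,4,5,3); (1,5,6,3);
    (2,3,6,3); (2,4,5,3); (2,5,6,3)]);
  ([:: (0,1); (2,3); (4,5)],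
   [:: (0,2,4,3); (0,2,5,3); (0,3,4,3); (0,3,6,3); (0,5,6,3); (1,2,4,3); (1,2,6,3);
    (1,3,5,6); (1,4,6,3); (2,5,6,3); (3,4,6,3)])].

Definition catalogue8 : seq (edge_list * weighted_triangles) := [::
  ([:: (0,1); (0,2); (0,3); (0,4)],
   [:: (0,5,6,3); (0,5,7,3); (0,6,7,3); (1,2,5,6); (1,3,6,6); (1,4,7,6); (2,3,7,6);
    (2,4,6,6); (3,4,5,6); (5,6,7,3)]);
  ([:: (0,1); (0,2); (0,3); (1,2)],
   [:: (0,4,7,6); (0,5,6,6); (1,3,4,3); (1,3,6,3); (1,4,5,3); (1,5,7,3); (1,6,7,3);
    (2,3,5,3); (2,3,7,3); (2,4,6,6); (2,5,7,3); (3,4,5,3); (3,6,7,3)]);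
  ([:: (0,1); (0,2); (0,3); (1,4)],
   [:: (0,4,6,6); (0,5,7,6); (1,2,3,3); (1,2,7,3); (1,3,5,3); (1,5,6,3); (1,6,7,3);
    (2,3,6,3); (2,4,5,3); (2,4,7,3); (2,5,6,3); (3,4,5,3); (3,4,7,3); (3,6,7,3)]);
  ([:: (0,1); (0,2); (0,3); (4,5)],
   [:: (0,4,7,6); (0,5,6,6); (1,2,4,3); (1,2,5,3); (1,3,6,3); (1,3,7,3); (1,4,6,3);
    (1,5,7,3); (2,3,4,3); (2,3,5,3); (2,6,7,6); (3,4,6,3); (3,5,7,3)]);
  ([:: (0,1); (0,2); (1,2); (3,4)],
   [:: (0,3,5,3); (0,3,6,3); (0,4,7,6); (0,5,6,3); (1,3,5,3); (1,3,7,3); (1,4,6,6);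
    (1,5,7,3); (2,3,6,3); (2,3,7,3); (2,4,5,6); (2,6,7,3); (5,6,7,3)]);
  ([:: (0,1); (0,2); (1,3); (2,3)],
   [:: (0,3,4,3); (0,3,6,3); (0,4,7,3); (0,5,6,3); (0,5,7,3); (1,2,5,3); (1,2,7,3);
    (1,4,6,3); (1,4,7,3); (1,5,6,3); (2,4,5,3); (2,4,6,3); (2,6,7,3); (3,4,5,3);
    (3,5,7,3); (3,6,7,3)]);
  ([:: (0,1); (0,2); (1,3); (2,4)],
   [:: (0,3,4,3); (0,3,7,3); (0,4,7,3); (0,5,6,6); (1,2,6,3); (1,2,7,3); (1,4,5,6);
    (1,6,7,3); (2,3,5,3); (2,3,6,3); (2,5,7,3); (3,4,6,3); (3,5,7,3); (4,6,7,3)]);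
  ([:: (0,1); (0,2); (1,3); (4,5)],
   [:: (0,3,4,3); (0,3,7,3); (0,4,7,3); (0,5,6,6); (1,2,4,3); (1,2,6,3); (1,4,6,3);
    (1,5,7,6); (2,3,5,6); (2,4,7,3); (2,6,7,3); (3,4,6,3); (3,6,7,3)]);
  ([:: (0,1); (0,2); (3,4); (5,6)],
   [:: (0,3,5,3); (0,3,7,3); (0,4,5,3); (0,4,6,3); (0,6,7,3); (1,2,4,3); (1,2,5,3);
    (1,3,6,6); (1,4,7,3); (1,5,7,3); (2,3,5,3); (2,3,7,3); (2,4,6,3); (2,6,7,3);
    (4,5,7,3)]);
  ([:: (0,1); (2,3); (4,5); (6,7)],
   [:: (0,2,4,6); (0,3,7,6); (0,5,6,6); (1,2,6,6); (1,3,5,6); (1,4,7,6); (2,5,7,6);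
    (3,4,6,6)]);
  ([:: (0,2); (0,3); (1,4); (1,5)],
   [:: (0,1,6,3); (0,1,7,3); (0,4,5,6); (0,6,7,3); (1,2,3,3); (1,2,6,3); (1,3,7,3);
    (2,3,4,3); (2,4,6,3); (2,5,7,6); (3,4,7,3); (3,5,6,6); (4,6,7,3)])].

Definition catalogue9 : seq (edge_list * weighted_triangles) := [::
  ([:: (0,1); (0,2); (0,3); (0,4); (0,5)],
   [:: (0,6,7,3); (0,6,8,3); (0,7,8,3); (1,2,4,1); (1,2,6,3); (1,2,8,2); (1,3,5,2);
    (1,3,6,1); (1,3,7,3); (1,4,6,2); (1,4,7,3); (1,5,8,4); (2,3,4,1); (2,3,6,1);
    (2,3,7,3); (2,3,8,1); (2,4,5,1); (2,4,6,2); (2,4,8,1); (2,5,7,3); (2,5,8,2);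
    (3,4,8,5); (3,5,6,4); (4,5,6,2); (4,5,7,3); (6,7,8,3)]);
  ([:: (0,1); (0,2); (0,3); (0,4); (1,2)],
   [:: (0,5,8,6); (0,6,7,6); (1,3,5,1); (1,3,6,4); (1,3,7,1); (1,4,5,1); (1,4,7,1);
    (1,4,8,4); (1,5,6,2); (1,5,7,2); (1,7,8,2); (2,3,4,2); (2,3,5,4); (2,4,7,4);
    (2,5,7,2); (2,6,8,6); (3,4,6,2); (3,4,8,2); (3,5,7,1); (3,7,8,4); (4,5,6,4);
    (4,5,7,1)]);
  ([:: (0,1); (0,2); (0,3); (0,4); (1,5)],
   [:: (0,5,6,2); (0,5,8,4); (0,6,7,4); (0,7,8,2); (1,2,6,3); (1,2,7,3); (1,3,4,3);
    (1,3,6,3); (1,4,8,3); (1,7,8,3); (2,3,5,1); (2,3,8,5); (2,4,5,3); (2,4,7,3);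
    (2,5,6,2); (2,6,8,1); (3,4,5,1); (3,4,6,2); (3,5,7,4); (3,6,7,1); (3,7,8,1);
    (4,5,7,2); (4,6,7,1); (4,6,8,3); (5,6,8,2)]);
  ([:: (0,1); (0,2); (0,3); (0,4); (5,6)],
   [:: (0,5,8,6); (0,6,7,6); (1,2,3,2); (1,2,5,4); (1,3,5,2); (1,3,7,2); (1,4,6,5);
    (1,4,8,1); (1,6,8,1); (1,7,8,4); (2,3,6,3); (2,3,7,1); (2,4,7,3); (2,4,8,3);
    (2,5,7,2); (2,6,8,3); (3,4,5,3); (3,4,6,1); (3,4,8,2); (3,5,7,1); (3,6,8,2);
    (3,7,8,2); (4,5,7,3)]);
  ([:: (0,1); (0,2); (0,3); (1,2); (1,3)],
   [:: (0,4,6,3); (0,4,7,3); (0,5,8,6); (0,6,7,3); (1,4,8,6); (1,5,6,3); (1,5,7,3);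
    (1,6,7,3); (2,3,4,2); (2,3,5,2); (2,3,7,2); (2,4,5,2); (2,4,6,2); (2,5,6,2);
    (2,6,8,2); (2,7,8,4); (3,4,5,2); (3,4,6,1); (3,4,7,1); (3,5,6,1); (3,5,7,1);
    (3,6,8,4); (3,7,8,2); (4,5,7,2)]);
  ([:: (0,1); (0,2); (0,3); (1,2); (1,4)],
   [:: (0,4,5,3); (0,4,7,1); (0,4,8,2); (0,5,7,3); (0,6,7,2); (0,6,8,4); (1,3,7,1);
    (1,3,8,5); (1,5,6,4); (1,5,7,2); (1,6,7,2); (1,7,8,1); (2,3,6,2); (2,3,7,4);
    (2,4,6,4); (2,4,7,2); (2,5,8,6); (3,4,5,3); (3,4,6,2); (3,4,8,1); (3,5,6,2);
    (3,5,7,1); (4,7,8,3); (6,7,8,2)]);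
  ([:: (0,1); (0,2); (0,3); (1,2); (3,4)],
   [:: (0,4,5,2); (0,4,7,4); (0,5,6,1); (0,5,8,3); (0,6,7,2); (0,6,8,3); (1,3,7,3);
    (1,3,8,3); (1,4,5,3); (1,4,6,3); (1,5,6,3); (1,7,8,3); (2,3,5,3); (2,3,6,3);
    (2,4,6,1); (2,4,8,5); (2,5,7,3); (2,6,7,2); (2,7,8,1); (3,5,6,1); (3,5,7,2);
    (3,6,8,2); (3,7,8,1); (4,5,8,1); (4,6,7,2); (5,6,8,1); (5,7,8,1)]);
  ([:: (0,1); (0,2); (0,3); (1,2); (4,5)],
   [:: (0,4,6,3); (0,4,8,3); (0,5,7,6); (0,6,8,3); (1,3,5,3); (1,3,6,2); (1,3,8,1);
    (1,4,6,1); (1,4,7,4); (1,4,8,1); (1,5,8,3); (1,6,7,2); (1,6,8,1); (2,3,4,5);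
    (2,3,8,1); (2,4,7,1); (2,5,6,6); (2,7,8,5); (3,4,7,1); (3,5,8,3); (3,6,7,4);
    (3,7,8,1); (4,6,8,2)]);
  ([:: (0,1); (0,2); (0,3); (1,4); (1,5)],
   [:: (0,4,5,4); (0,4,6,1); (0,4,7,1); (0,5,7,2); (0,6,7,1); (0,6,8,4); (0,7,8,2);
    (1,2,6,6); (1,3,7,3); (1,3,8,3); (1,7,8,3); (2,3,4,4); (2,3,7,2); (2,4,8,2);
    (2,5,7,3); (2,5,8,3); (2,7,8,1); (3,4,8,2); (3,5,6,5); (3,5,7,1); (3,6,8,1);
    (4,5,8,2); (4,6,7,5); (5,6,8,1)]);
  ([:: (0,1); (0,2); (0,3); (1,4); (2,5)],
   [:: (0,4,5,2); (0,4,6,1); (0,4,7,3); (0,5,8,4); (0,6,7,3); (0,6,8,2); (1,2,6,5);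
    (1,2,7,1); (1,3,5,5); (1,3,8,1); (1,5,6,1); (1,7,8,5); (2,3,7,5); (2,3,8,1);
    (2,4,6,1); (2,4,8,5); (3,4,5,1); (3,4,6,4); (3,4,8,1); (3,6,8,2); (3,7,8,1);
    (4,5,7,3); (5,6,7,3); (5,6,8,2)]);
  ([:: (0,1); (0,2); (0,3); (1,4); (5,6)],
   [:: (0,4,5,3); (0,4,6,1); (0,4,8,2); (0,5,8,3); (0,6,7,5); (0,7,8,1); (1,2,6,2);
    (1,2,7,1); (1,2,8,3); (1,3,6,4); (1,3,8,2); (1,5,7,5); (1,5,8,1); (2,3,4,1);
    (2,3,5,5); (2,4,5,1); (2,4,7,4); (2,6,7,1); (2,6,8,3); (3,4,5,1); (3,4,6,2);
    (3,4,7,2); (3,7,8,4); (4,5,8,1); (4,6,8,3); (5,7,8,1)]);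
  ([:: (0,1); (0,2); (0,3); (4,5); (6,7)],
   [:: (0,4,6,6); (0,5,7,3); (0,5,8,3); (0,7,8,3); (1,2,4,2); (1,2,7,2); (1,2,8,2);
    (1,3,4,1); (1,3,6,2); (1,3,7,3); (1,4,8,3); (1,5,6,4); (1,5,7,1); (1,5,8,1);
    (2,3,5,5); (2,3,6,1); (2,4,7,4); (2,5,6,1); (2,6,8,4); (3,4,7,2); (3,4,8,3);
    (3,5,6,1); (3,6,8,2); (3,7,8,1); (5,7,8,2)]);
  ([:: (0,1); (0,2); (0,4); (1,3); (2,3)],
   [:: (0,3,7,5); (0,3,8,1); (0,5,6,3); (0,5,7,1); (0,5,8,2); (0,6,8,3); (1,2,4,2);
    (1,2,8,4); (1,4,5,2); (1,4,6,2); (1,5,7,4); (1,6,7,2); (1,6,8,2); (2,4,5,4);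
    (2,5,6,1); (2,5,7,1); (2,6,7,4); (2,6,8,1); (2,7,8,1); (3,4,6,4); (3,4,7,1);
    (3,4,8,1); (3,5,6,2); (3,5,8,4); (4,7,8,5)]);
  ([:: (0,1); (0,2); (1,2); (3,4); (3,5)],
   [:: (0,3,6,6); (0,4,5,2); (0,4,7,4); (0,5,8,4); (0,7,8,2); (1,3,7,6); (1,4,6,1);
    (1,4,8,5); (1,5,6,5); (1,5,8,1); (2,3,8,6); (2,4,5,2); (2,4,6,4); (2,5,7,4);
    (2,6,7,2); (4,5,7,2); (4,6,8,1); (5,6,8,1); (6,7,8,4)]);
  ([:: (0,1); (0,2); (1,2); (3,4); (5,6)],
   [:: (0,3,6,5); (0,3,7,1); (0,4,5,3); (0,4,7,3); (0,5,8,3); (0,6,8,1); (0,7,8,2);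
    (1,3,5,6); (1,4,7,2); (1,4,8,4); (1,6,7,4); (1,6,8,2); (2,3,7,2); (2,3,8,4);
    (2,4,5,2); (2,4,6,4); (2,5,7,4); (2,6,8,2); (3,6,7,1); (3,7,8,2); (4,5,8,1);
    (4,6,7,1); (4,6,8,1); (5,7,8,2)]);
  ([:: (0,1); (0,2); (1,3); (2,3); (4,5)],
   [:: (0,3,4,1); (0,3,5,2); (0,3,6,1); (0,3,8,2); (0,4,6,1); (0,4,7,3); (0,4,8,1);
    (0,5,6,4); (0,7,8,3); (1,2,4,2); (1,2,5,3); (1,2,6,1); (1,4,8,4); (1,5,7,3);
    (1,6,7,3); (1,6,8,2); (2,4,7,3); (2,4,8,1); (2,5,8,3); (2,6,7,3); (2,6,8,2);
    (3,4,6,5); (3,5,7,3); (3,5,8,1); (3,7,8,3); (5,6,8,2)]);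
  ([:: (0,1); (0,2); (1,3); (2,4); (3,4)],
   [:: (0,3,5,2); (0,3,7,2); (0,3,8,2); (0,4,5,2); (0,4,7,4); (0,5,6,2); (0,6,8,4);
    (1,2,5,4); (1,2,8,2); (1,4,6,2); (1,4,8,4); (1,5,7,2); (1,6,7,4); (2,3,6,4);
    (2,3,7,2); (2,5,7,2); (2,6,8,2); (2,7,8,2); (3,5,8,4); (3,6,7,2); (4,5,6,4);
    (4,7,8,2); (5,7,8,2)]);
  ([:: (0,1); (0,2); (1,3); (2,4); (3,5)],
   [:: (0,3,4,3); (0,3,8,3); (0,4,6,3); (0,5,7,4); (0,5,8,2); (0,6,7,2); (0,6,8,1);
    (1,2,5,5); (1,2,7,1); (1,4,7,3); (1,4,8,3); (1,5,6,1); (1,6,7,2); (1,6,8,3);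
    (2,3,6,5); (2,3,7,1); (2,5,8,1); (2,6,8,1); (2,7,8,4); (3,4,7,3); (3,6,8,1);
    (3,7,8,2); (4,5,6,3); (4,5,8,3); (5,6,7,2)]);
  ([:: (0,1); (0,2); (1,3); (2,4); (5,6)],
   [:: (0,3,6,3); (0,3,7,3); (0,4,5,3); (0,4,7,3); (0,5,8,3); (0,6,8,3); (1,2,5,2);
    (1,2,8,4); (1,4,6,6); (1,5,7,4); (1,7,8,2); (2,3,5,4); (2,3,7,1); (2,3,8,1);
    (2,6,7,5); (2,6,8,1); (3,4,5,2); (3,4,7,1); (3,4,8,3); (3,6,7,1); (3,6,8,2);
    (4,5,8,1); (4,7,8,2); (5,7,8,2)]);
  ([:: (0,1); (0,2); (1,3); (4,5); (6,7)],
   [:: (0,3,7,5); (0,3,8,1); (0,4,7,1); (0,4,8,5); (0,5,6,6); (1,2,4,1); (1,2,5,1);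
    (1,2,6,3); (1,2,8,1); (1,4,6,3); (1,4,7,1); (1,4,8,1); (1,5,7,3); (1,5,8,2);
    (1,7,8,2); (2,3,4,2); (2,3,5,4); (2,4,7,3); (2,5,7,1); (2,6,8,3); (2,7,8,2);
    (3,4,6,3); (3,4,7,1); (3,5,8,2); (3,6,8,3); (5,7,8,2)]);
  ([:: (0,1); (0,2); (3,4); (5,6); (7,8)],
   [:: (0,3,7,3); (0,3,8,3); (0,4,5,3); (0,4,6,3); (0,5,8,3); (0,6,7,3); (1,2,3,2);
    (1,2,6,2); (1,2,8,2); (1,3,5,3); (1,3,7,1); (1,4,5,2); (1,4,7,4); (1,5,7,1);
    (1,6,8,4); (2,3,6,4); (2,4,5,1); (2,4,7,1); (2,4,8,4); (2,5,7,5); (3,5,8,3);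
    (3,6,7,2); (4,6,7,1); (4,6,8,2)]);
  ([:: (0,1); (0,3); (0,4); (1,2); (2,5)],
   [:: (0,2,8,6); (0,5,6,3); (0,5,7,3); (0,6,7,3); (1,3,4,3); (1,3,5,3); (1,4,6,1);
    (1,4,7,2); (1,5,6,1); (1,5,7,2); (1,6,8,4); (1,7,8,2); (2,3,6,4); (2,3,7,2);
    (2,4,6,2); (2,4,7,4); (3,4,6,1); (3,4,8,2); (3,5,7,1); (3,5,8,2); (3,6,7,1);
    (3,7,8,2); (4,5,6,2); (4,5,8,4); (6,7,8,2)]);
  ([:: (0,1); (0,3); (1,4); (2,5); (2,6)],
   [:: (0,2,7,1); (0,2,8,5); (0,4,5,5); (0,4,6,1); (0,5,7,1); (0,6,7,4); (0,6,8,1);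
    (1,2,3,4); (1,2,7,2); (1,3,7,2); (1,5,6,4); (1,5,8,2); (1,6,8,2); (1,7,8,2);
    (2,3,4,2); (2,4,7,3); (2,4,8,1); (3,4,6,4); (3,5,7,3); (3,5,8,3); (3,6,8,2);
    (3,7,8,1); (4,5,8,1); (4,6,8,1); (4,7,8,3); (5,6,7,2)]);
  ([:: (0,2); (0,3); (0,4); (1,5); (1,6)],
   [:: (0,1,7,3); (0,1,8,3); (0,5,6,6); (0,7,8,3); (1,2,3,3); (1,2,8,3); (1,3,4,3);
    (1,4,7,3); (2,3,6,1); (2,3,7,2); (2,4,5,5); (2,4,8,1); (2,5,8,1); (2,6,7,4);
    (2,6,8,1); (3,4,6,2); (3,4,8,1); (3,5,7,4); (3,5,8,2); (3,6,8,3); (4,5,8,1);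
    (4,6,7,2); (4,6,8,2); (4,7,8,1); (5,7,8,2)]);
  ([:: (0,2); (0,3); (1,4); (1,5); (6,7)],
   [:: (0,1,6,4); (0,1,8,2); (0,4,5,3); (0,4,6,2); (0,4,8,1); (0,5,7,3); (0,7,8,3);
    (1,2,7,6); (1,3,6,2); (1,3,8,4); (2,3,5,5); (2,3,6,1); (2,4,6,2); (2,4,8,4);
    (2,5,6,1); (2,6,8,2); (3,4,7,6); (3,5,6,1); (3,6,8,2); (4,5,6,2); (4,5,8,1);
    (5,6,8,2); (5,7,8,3)])].

Definition catalogue := catalogue7 ++ catalogue8 ++ catalogue9.

Section Catalogue.
Local Open Scope nat_scope.

Definition joined (F : edge_list) a b := ((a, b) \in F) || ((b, a) \in F).

Definition genuine N (e : nat * nat * nat * nat) :=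
  let: (p, q, t, w) := e in [&& p != q, p != t, q != t, p < N, q < N & t < N].

Definition corners (e : nat * nat * nat * nat) :=
  let: (p, q, t, w) := e in [:: p; q; t].

(** The diagonal is skipped, and [6] is the common denominator of the weights. *)
Definition certified N (c : edge_list * weighted_triangles) :=
  all (fun a => all (fun b => (a == b) ||
    (sumn [seq ((a \in corners e) && (b \in corners e)) * e.2 | e <- c.2 & genuine N e]
      == 6 * ~~ joined c.1 a b)) (iota 0 N)) (iota 0 N).

Definition graph_types k : seq edge_list := [seq c.1 | c <- catalogue & size c.1 == k].

Definition vertex_count (F : edge_list) := foldr (fun e m => maxn (maxn e.1 e.2).+1 m) 0 F.

(** Up to isomorphism, a new missing pair joins two old vertices, an old vertex to the
    first unused one, or the first two unused ones. *)
Definition new_edges F := let n := vertex_count F in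
  [seq e <- allpairs pair (iota 0 n) (iota 0 n) | (e.1 < e.2) && ~~ joined F e.1 e.2]
  ++ [seq (a, n) | a <- iota 0 n] ++ [:: (n, n.+1)].

Definition extensions : seq edge_list :=
  [seq E <- flatten [seq [seq e :: F | e <- new_edges F] | F <- flatten (mkseq graph_types 5)]
  | vertex_count E <= 9].

(** The permutation [s] carries the numbering of [F] to that of [E]. *)
Definition isomorphic_by (E F : edge_list) (s : seq nat) :=
  perm_eq s (iota 0 (vertex_count E)) && (vertex_count F == vertex_count E) &&
  all (fun a => all (fun b => joined F a b == joined E (nth 0 s a) (nth 0 s b))
        (iota 0 (vertex_count E))) (iota 0 (vertex_count E)).

(** The search for an isomorphism is by backtracking and prunes by degrees.  Nothing
    is claimed about it: its results are checked by [isomorphic_by]. *)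
Definition valence (F : edge_list) a := count (joined F a) (iota 0 (vertex_count F)).

Fixpoint place (E F : edge_list) fuel (s : seq nat) : seq nat :=
  if fuel is fuel'.+1 then
    (fix try cs :=
       if cs is c :: cs' then
         if [&& c \notin s, valence E c == valence F (size s) &
             all (fun i => joined F i (size s) == joined E (nth 0 s i) c) (iota 0 (size s))]
         then (let r := place E F fuel' (rcons s c) in if nilp r then try cs' else r)
         else try cs'
       else [::]) (iota 0 (vertex_count E))
  else s.

Definition identify (E : edge_list) : edge_list * seq nat :=
  (fix try Fs := if Fs is F :: Fs' then
      (let s := place E F (vertex_count E) [::] in
       if ~~ nilp s && isomorphic_by E F s then (F, s) else try Fs')
    else ([::], [::])) (graph_types (size E)).

(** Evaluated once and for all, so that the next proofs only check the result. *)
Definition identifications := Eval vm_compute in map identify extensions.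

Lemma catalogue_certified :
  all (fun c => certified (maxn 7 (size c.1 + 4)) c) catalogue.
Proof. by vm_compute. Qed.

Lemma extensions_identified :
  all2 (fun E Fs => (Fs.1 \in graph_types (size E)) && isomorphic_by E Fs.1 Fs.2)
    extensions identifications.
Proof. by vm_compute. Qed.

End Catalogue.

Lemma joinedC F a b : joined F a b = joined F b a.
Proof. by rewrite /joined orbC. Qed.

Lemma joined_cons a b F c d : joined ((a, b) :: F) c d =
  joined F c d || ((c == a) && (d == b) || (c == b) && (d == a)).
Proof. 
rewrite /joined !inE !xpair_eqE (andbC (d == a)).
by rewrite orbACA orbC.
Qed.

Lemma joined_lt F a b : joined F a b -> (a < vertex_count F)%N && (b < vertex_count F)%N.
Proof.
have H e : e \in F -> (e.1 < vertex_count F)%N && (e.2 < vertex_count F)%N.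
  elim: F => //= f F IH; rewrite inE => /predU1P[->|/IH]; lia.
by case/orP => /H //; rewrite andbC.
Qed.

Lemma all2_mem (U V : eqType) (r : U -> V -> bool) (us : seq U) vs u :
  all2 r us vs -> u \in us -> exists v, r u v.
Proof.
elim: us vs => [|u' us IH] [|v vs] //= /andP[rv /IH{}IH].
by rewrite inE => /predU1P[->|/IH//]; exists v.
Qed.

Section Classify.
Variables (T : finType) (A : {set T}) (x0 : T).
Implicit Types (h : rel T) (F E : edge_list) (s : seq T).

(** The graph [h] on [A] is isomorphic to [F], up to vertices without missing pairs;
    [s] lists the vertices of [A] that correspond to the numbers below
    [vertex_count F]. *)
Definition drawn h F s :=
  [/\ uniq s, {subset s <= A}, size s = vertex_count F,
      forall a b, (a < size s)%N -> (b < size s)%N ->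
        h (nth x0 s a) (nth x0 s b) = joined F a b
    & forall x y, x \in A -> y \in A -> x \notin s -> h x y = false].

Lemma drawn_isomorphic h E F s p : isomorphic_by E F p -> drawn h E s ->
  drawn h F [seq nth x0 s c | c <- p].
Proof.
case/andP=> /andP[pp /eqP FE] /allP iso [us sA ss hs ho].
have sp : size p = vertex_count E by rewrite (perm_size pp) size_iota.
have pE c : c \in p = (c < vertex_count E)%N by rewrite (perm_mem pp) mem_iota.
have up : uniq p by rewrite (perm_uniq pp) iota_uniq.
have mems z : (z \in [seq nth x0 s c | c <- p]) = (z \in s).
  apply/mapP/idP => [[c]|zs]; first by rewrite pE -ss => cs ->; apply: mem_nth.
  by exists (index z s); rewrite ?nth_index // pE -ss index_mem.
split.
- rewrite map_inj_in_uniq // => c d; rewrite !pE -ss => cs ds /eqP.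
  by rewrite nth_uniq // => /eqP.
- by move=> z; rewrite mems; apply: sA.
- by rewrite size_map sp FE.
- move=> a b; rewrite size_map sp => aE bE; rewrite !(nth_map 0%N) ?sp //.
  have nE c : (c < vertex_count E)%N -> (nth 0%N p c < size s)%N.
    by move=> cE; rewrite ss -pE mem_nth // sp.
  rewrite hs ?nE //; have := iso a; rewrite mem_iota => /(_ aE) /allP /(_ b).
  by rewrite mem_iota => /(_ bE) /eqP.
- by move=> x y xA yA; rewrite mems; apply: ho.
Qed.

(** The endpoints of the new pair [x y] that are not yet in [s] are appended to it, so
    that they get the first unused numbers.  As both numberings of the pair give the same
    graph, the endpoint that comes first in [s] may be called [x]. *)
Lemma drawn_extend h h' F s x y : (#|A| <= 9)%N -> F \in flatten (mkseq graph_types 5) ->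
  drawn h' F s -> x \in A -> y \in A -> x != y -> symmetric h' -> h' x y = false ->
  (forall u v, h u v = h' u v || ((u == x) && (v == y) || (u == y) && (v == x))) ->
  exists E s', [/\ E \in extensions, size E = (size F).+1 & drawn h E s'].
Proof.
move=> A9 FT; move=> dr.
wlog xy : x y / (index x s <= index y s)%N.
  move=> W xA yA nxy hs hxy hE; have [|/ltnW] := leqP (index x s) (index y s).
    by move=> le; apply: (W x y).
  move=> le; apply: (W y x) => //; [by rewrite eq_sym|by rewrite hs|].
  by move=> u v; rewrite hE; congr (_ || _); rewrite orbC.
move=> xA yA nxy h'_sym hxy hE; case: dr => us sA ss hs ho.
suff [a [b [s' [us' s'A ss' /andP[xs' ys'] [abE cat_s']]]]] : exists a b s',
   [/\ uniq s', {subset s' <= A}, size s' = vertex_count ((a, b) :: F),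
       ((a < size s')%N && (nth x0 s' a == x)) && ((b < size s')%N && (nth x0 s' b == y))
     & (a, b) \in new_edges F /\ exists t, s' = s ++ t].
  case: cat_s' => t s'E.
  have bound : (vertex_count ((a, b) :: F) <= 9)%N.
    rewrite -ss'; apply: leq_trans A9; rewrite -(card_uniqP us').
    by apply: subset_leq_card; apply/subsetP.
  exists ((a, b) :: F), s'; split=> //.
    rewrite mem_filter bound andTb; apply/flattenP.
    exists [seq e :: F | e <- new_edges F]; first by apply/mapP; exists F.
    by apply/mapP; exists (a, b).
  case/andP: xs' => xs' /eqP xE; case/andP: ys' => ys' /eqP yE.
  have nth_out c : (c < size s')%N -> (size s <= c)%N -> nth x0 s' c \notin s.
    move=> cs' sc; rewrite s'E nth_cat ltnNge sc /=.
    move: us'; rewrite s'E cat_uniq => /and3P[_ /hasPn st _]; apply: st.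
    by apply: mem_nth; rewrite ltn_subLR // -size_cat -s'E.
  have nthA c : (c < size s')%N -> nth x0 s' c \in A by move=> cs; apply/s'A/mem_nth.
  have h'E c d : (c < size s')%N -> (d < size s')%N ->
      h' (nth x0 s' c) (nth x0 s' d) = joined F c d.
    move=> cs ds; have [cs1|cs1] := ltnP c (size s); have [ds1|ds1] := ltnP d (size s).
    - by rewrite s'E !nth_cat cs1 ds1 hs.
    - rewrite h'_sym ho ?nthA ?nth_out //; apply/esym/negbTE/negP => /joined_lt.
      by rewrite -ss; lia.
    - rewrite ho ?nthA ?nth_out //; apply/esym/negbTE/negP => /joined_lt.
      by rewrite -ss; lia.
    - rewrite ho ?nthA ?nth_out //; apply/esym/negbTE/negP => /joined_lt.
      by rewrite -ss; lia.
  split=> //.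
    by move=> c d cs ds; rewrite hE h'E // joined_cons -xE -yE !nth_uniq.
  move=> u v uA vA us1; rewrite hE ho //=; last first.
    by apply: contra us1; rewrite s'E mem_cat => ->.
  apply/negbTE; rewrite negb_or !negb_and.
  have -> : u != x by apply: contraNneq us1 => ->; rewrite -xE mem_nth.
  by have -> : u != y by apply: contraNneq us1 => ->; rewrite -yE mem_nth.
have memL e : e \in new_edges F =
    [|| e \in [seq e <- allpairs pair (iota 0 (vertex_count F)) (iota 0 (vertex_count F))
                | (e.1 < e.2)%N && ~~ joined F e.1 e.2],
        e \in [seq (a, vertex_count F) | a <- iota 0 (vertex_count F)]
      | e == (vertex_count F, (vertex_count F).+1)].
  by rewrite /new_edges !mem_cat inE.
have [ys|ys] := boolP (y \in s).
  have xs : x \in s by rewrite -index_mem (leq_ltn_trans xy) // index_mem.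
  have ltxy : (index x s < index y s)%N.
    rewrite ltn_neqAle xy andbT; apply: contra nxy => /eqP e.
    by rewrite -(nth_index x0 xs) e nth_index.
  exists (index x s), (index y s), s; split=> //.
  - by move: xs ys; rewrite -!index_mem /= ss; clear; lia.
  - by rewrite !index_mem xs ys !nth_index // !eqxx.
  split; last by exists [::]; rewrite cats0.
  rewrite memL mem_filter ltxy /= -hs ?index_mem // !nth_index // hxy /=.
  by rewrite allpairs_f // mem_iota -ss index_mem.
have [xs|xs] := boolP (x \in s).
  exists (index x s), (vertex_count F), (rcons s y); split.
  - by rewrite rcons_uniq ys.
  - by move=> z; rewrite mem_rcons inE => /predU1P[->|/sA].
  - by move: xs; rewrite -index_mem size_rcons /= -ss; clear; lia.
  - by rewrite size_rcons !nth_rcons index_mem xs nth_index // -ss ltnn !eqxx ltnS index_size ltnSn.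
  split; last by exists [:: y]; rewrite cats1.
  by rewrite memL map_f ?orbT // mem_iota -ss index_mem.
exists (vertex_count F), (vertex_count F).+1, (s ++ [:: x; y]); split.
- by rewrite cat_uniq us /= !inE (negPf xs) (negPf ys) nxy.
- by move=> z; rewrite mem_cat !inE => /or3P[/sA|/eqP->|/eqP->].
- by rewrite size_cat /= -ss; clear; lia.
- have n1 : nth x0 (s ++ [:: x; y]) (size s) = x by rewrite nth_cat ltnn subnn.
  have n2 : nth x0 (s ++ [:: x; y]) (size s).+1 = y.
    by rewrite nth_cat ltnNge leqnSn subSnn.
  by rewrite -ss n1 n2 !eqxx size_cat !andbT addn2 ltnSn ltnW.
split; last by exists [:: x; y].
by rewrite memL eqxx !orbT.
Qed.

(** Missing pairs are added one at a time, and each resulting graph is replaced by the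
    isomorphic one in the catalogue. *)
Lemma classified h k : symmetric h -> irreflexive h -> (#|A| <= 9)%N -> (k <= 5)%N ->
  missing h A = (2 * k)%N -> exists2 F, F \in graph_types k & exists s, drawn h F s.
Proof.
move=> h_sym h_irr A9; elim: k h h_sym h_irr => [|k IH] h h_sym h_irr k5 mh.
  exists [::] => //; exists [::]; split=> // x y xA yA _.
  exact: (missing_eq0 mh xA yA).
have [x xA [y yA hxy]] : exists2 x, x \in A & exists2 y, y \in A & h x y.
  case: (pickP [pred e : T * T | [&& e.1 \in A, e.2 \in A & h e.1 e.2]]) => [[x y]|no].
    by case/and3P => /= xA yA hxy; exists x => //; exists y.
  move: mh; rewrite /missing big1 ?mulnS // => x xA.
  by apply: big1 => y yA; have := no (x, y); rewrite /= xA yA /= => ->.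
have xy : x != y by apply: contraTneq hxy => ->; rewrite h_irr.
pose e u v := (u == x) && (v == y) || (u == y) && (v == x).
pose h' u v := h u v && ~~ e u v.
have e_sym : symmetric e by move=> u v; rewrite /e orbC (andbC (v == y)) (andbC (v == x)).
have h'_sym : symmetric h' by move=> u v; rewrite /h' h_sym e_sym.
have h'_irr : irreflexive h' by move=> u; rewrite /h' h_irr.
have h'xy : h' x y = false by rewrite /h' /e !eqxx andbF.
have hE u v : h u v = h' u v || e u v.
  rewrite /h'; case: (boolP (e u v)) => [|_]; last by rewrite andbT orbF.
  by case/orP => /andP[/eqP-> /eqP->]; rewrite ?(h_sym y) hxy orbT.
have mh' : missing h' A = (2 * k)%N.
  have := missingD1 h_sym h_irr xA; have := missingD1 h'_sym h'_irr xA.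
  rewrite (degreeD1 h x yA) (degreeD1 h' x yA) hxy h'xy addn0.
  have -> : missing h' (A :\ x) = missing h (A :\ x).
    apply: eq_bigr => u; rewrite in_setD1 => /andP[/negPf ux _].
    apply: eq_bigr => v; rewrite in_setD1 => /andP[/negPf vx _].
    by rewrite hE /e ux vx /= andbF orbF.
  have -> : degree h' (A :\ y) x = degree h (A :\ y) x.
    apply: eq_bigr => v; rewrite in_setD1 => /andP[/negPf vy _].
    by rewrite hE /e vy (negPf xy) andbF !orbF.
  by rewrite mh; lia.
have [F Fk [s dr]] := IH h' h'_sym h'_irr (ltnW k5) mh'.
have FT : F \in flatten (mkseq graph_types 5).
  by apply/flattenP; exists (graph_types k) => //; apply/mapP; exists k => //; rewrite mem_iota.
have sF : size F = k by case/mapP: Fk => c; rewrite mem_filter => /andP[/eqP ? _] ->.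
have [E [s' [Eext sE dr']]] := drawn_extend A9 FT dr xA yA xy h'_sym h'xy hE.
have [[F' p] /= /andP[F'k iso]] := all2_mem extensions_identified Eext.
exists F'; first by rewrite sE sF in F'k.
by eexists; apply: drawn_isomorphic iso dr'.
Qed.

End Classify.

(** The number of vertices is the one for which the entries with [k] missing pairs are
    certified. *)
Lemma decomposable_catalogued (R : realFieldType) (T : finType) (A : {set T})
    (h : rel T) (k : nat) :
  symmetric h -> irreflexive h -> missing h A = (2 * k)%N -> (k <= 5)%N ->
  #|A| = maxn 7 (k + 4) -> decomposable (demand A (fun x y => (h x y)%:R : R)).
Proof.
move=> h_sym h_irr mh k5 cA; have A9 : (#|A| <= 9)%N by rewrite cA; lia.
have [x0 x0A] : exists x, x \in A by apply/card_gt0P; rewrite cA; lia.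
have [F Fk [s [us sA ss hs ho]]] := classified x0 h_sym h_irr A9 k5 mh.
have [[F' W] cin [sF FE]] : exists2 c, c \in catalogue & size c.1 = k /\ c.1 = F.
  case/mapP: Fk => c; rewrite mem_filter => /andP[/eqP sc cc] ->.
  by exists c.
have := allP catalogue_certified _ cin; rewrite /= in FE sF *; rewrite {}FE in sF * => cert.
rewrite sF -cA in cert.
pose S := s ++ [seq z <- enum A | z \notin s].
have uS : uniq S.
  rewrite cat_uniq us filter_uniq ?enum_uniq // andbT /=.
  by apply/hasPn => z; rewrite mem_filter => /andP[].
have memS z : (z \in S) = (z \in A).
  rewrite mem_cat mem_filter mem_enum; case: (boolP (z \in s)) => //= /sA -> //.
have sS : size S = #|A| by rewrite -(card_uniqP uS); apply: eq_card.
have hS x y : x \in A -> y \in A -> h x y = joined F (index x S) (index y S).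
  have out z : z \in A -> z \notin s -> forall b, joined F (index z S) b = false.
    move=> zA zs b; apply/negbTE/negP => /joined_lt /andP[+ _].
    by rewrite index_cat (negPf zs) -ss ltnNge leq_addr.
  move=> xA yA; have [xs|xs] := boolP (x \in s); last by rewrite ho // out.
  have [ys|ys] := boolP (y \in s); last by rewrite h_sym ho // joinedC out.
  by rewrite !index_cat xs ys -hs ?index_mem // !nth_index.
pose tri (e : nat * nat * nat * nat) := [set x in A | index x S \in corners e].
have tri3 e : genuine #|A| e -> (2 < #|tri e|)%N.
  case: e => [[[p q] t] w] /and5P[pq pt qt pA /andP[qA tA]].
  have u3 : uniq [:: nth x0 S p; nth x0 S q; nth x0 S t].
    by rewrite /= !inE !nth_uniq ?sS // negb_or pq pt qt.
  apply: (@leq_trans #|[:: nth x0 S p; nth x0 S q; nth x0 S t]|).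
    by rewrite (card_uniqP u3).
  apply: subset_leq_card; apply/subsetP => x.
  by rewrite !inE -memS => /or3P[] /eqP->; rewrite mem_nth ?sS // index_uniq ?sS // eqxx ?orbT.
have dec e : genuine #|A| e ->
    decomposable (fun x y => (e.2)%:R / 6 * ((x \in tri e)%:R * (y \in tri e)%:R) : R).
  by move=> ge; apply: decomposableZ; [rewrite divr_ge0 | exact: decomposable_clique (tri3 e ge)].
apply: decomposable_ext (decomposable_sum W dec) => x y xy; rewrite /demand.
case: (boolP (x \in A)) => xA; last first.
  by rewrite big1 ?mul0r // => e _; rewrite inE (negPf xA) mul0r mulr0.
case: (boolP (y \in A)) => yA; last first.
  by rewrite big1 ?mulr0 ?mul0r // => e _; rewrite [y \in _]inE (negPf yA) !mulr0.
have ix : (index x S < #|A|)%N by rewrite -sS index_mem memS.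
have iy : (index y S < #|A|)%N by rewrite -sS index_mem memS.
have := allP cert (index x S); rewrite mem_iota => /(_ ix) /allP /(_ (index y S)).
rewrite mem_iota => /(_ iy) /orP[/eqP ixy|/eqP].
  by move: xy; rewrite -(@nth_index _ x0 x S) ?memS // ixy nth_index ?memS // eqxx.
rewrite /= sumnE big_map big_filter -hS // => /(congr1 (fun n => n%:R / 6 : R)).
rewrite natr_sum mulr_suml => sumE.
rewrite !mul1r -[RHS](_ : (6 * ~~ h x y)%N%:R / 6 = _); last first.
  by rewrite natrM; case: (h x y) => /=; field.
rewrite -sumE; apply: eq_bigr => e _.
by rewrite !inE xA yA /= natrM -mulnb natrM; ring.
Qed.

(** * The induction and the theorem *)
Lemma all_resilient (R : realFieldType) (T : finType) (A : {set T}) :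
  (7 <= #|A|)%N -> resilient R A.
Proof.
have [n] := ubnP #|A|; elim: n A => // n IH A An A7.
have smaller (B : {set T}) : (7 <= #|B| < #|A|)%N -> resilient R B.
  by case/andP=> B7 BA; apply: IH => //; apply: leq_trans BA _.
apply: resilient_of_graphs; first by lia.
move=> h h_sym h_irr; rewrite total_weight_missing => mR.
have few : (missing h A + 8 <= 2 * #|A|)%N.
  by rewrite -(ler_nat R) natrD natrM; lra.
have [k mk] := missing_even h_sym h_irr A.
have [tight|loose] := eqVneq (missing h A + 8)%N (2 * #|A|)%N; last first.
  have [A8|A8] := ltnP 7 #|A|; last by apply: (decomposable_catalogued R h_sym h_irr mk); lia.
  apply: (decomposable_average h_sym h_irr smaller) => // x xA.
  by have := missingD1 h_sym h_irr xA; move: mk few loose => mk few /eqP; lia.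
have [A10|A9] := leqP 10 #|A|; last first.
  by apply: (decomposable_catalogued R h_sym h_irr mk); lia.
have A8 : (8 <= #|A|)%N by lia.
have [/exists_inP[c cA Dc]|/exists_inPn small] :=
    boolP [exists c in A, #|A| < 3 * degree h A c]%N.
  exact: (decomposable_hub h_sym h_irr smaller few A8 cA Dc).
have {}small : {in A, forall u, 3 * degree h A u <= #|A|}%N.
  by move=> u uA; rewrite leqNgt small.
pose I := [set v in A | degree h A v == 0%N].
have IA : I \subset A by apply/subsetP => v; rewrite inE => /andP[].
have I_isolated v : v \in I -> degree h A v = 0%N by rewrite inE => /andP[_ /eqP].
have J_degree : {in A :\: I, forall u, 0 < degree h A u}%N.
  by move=> u; rewrite !inE => /andP[+ uA]; rewrite uA lt0n.
have cJI : (#|A :\: I| + #|I| = #|A|)%N.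
  by rewrite cardsD (setIidPr IA) subnK // subset_leq_card.
have [I0|I0] := posnP #|I|.
  apply: (decomposable_average h_sym h_irr smaller) => // x xA.
  have : (0 < degree h A x)%N by apply: J_degree; rewrite (cards0_eq I0) setD0.
  by have := missingD1 h_sym h_irr xA; move: tight; lia.
have [I2|I3] := leqP #|I| 2.
  by apply: (decomposable_few_isolated h_sym h_irr smaller few IA) => //; rewrite I0.
have [JI|IJ] := leqP #|A :\: I| (#|I| + 2).
  exact: (decomposable_many_isolated R h_sym h_irr IA I_isolated A8 few I3 J_degree JI).
have IJ3 : (#|I| + 3 <= #|A :\: I|)%N by rewrite addnS.
have [JM|MJ] := leqP #|A :\: I| (\sum_(u in A :\: I) minn #|I| (degree h A u).-1 + 2).
  exact: (decomposable_full_deletion h_sym h_irr smaller IA I_isolated tight A10 J_degree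
            small I3 IJ3 JM).
exact: (decomposable_dominant_hub h_sym h_irr smaller IA I_isolated tight A10 J_degree
          small I3 MJ).
Qed.

Lemma card_edges (T : finType) (G : sgraph T) :
  (2 * #|edges G| = \sum_x \sum_y G x y)%N.
Proof.
pose D := [set e : T * T | G e.1 e.2].
have -> : (\sum_x \sum_y G x y = #|D|)%N.
  rewrite pair_big -sum1_card [RHS]big_mkcond; apply: eq_bigr => -[x y] _ /=.
  by rewrite inE; case: (G x y).
pose f (e : T * T) := [set e.1; e.2].
have -> : edges G = f @: D.
  apply/setP => E; rewrite inE; apply/existsP/imsetP.
    by case=> x /existsP[y /andP[xy /eqP->]]; exists (x, y); rewrite ?inE.
  by case=> -[x y]; rewrite inE => xy ->; exists x; apply/existsP; exists y; rewrite xy /f /=.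
rewrite -[RHS]sum1_card (partition_big_imset f) /= mulnC -sum_nat_const.
apply: eq_bigr => _ /imsetP[[x y] + ->]; rewrite inE /= => xy.
have nxy : x != y by apply: contraTneq xy => ->; rewrite adj_irr.
rewrite sum1dep_card (_ : [set _ | _] = [set (x, y); (y, x)]).
  by rewrite cards2 xpair_eqE negb_and nxy.
apply/setP => -[u v]; rewrite !inE /f /= !xpair_eqE.
apply/andP/orP => [[uv /eqP E]|[] /andP[/eqP-> /eqP->]]; last 2 first.
- by rewrite xy.
- by rewrite adj_sym xy setUC.
have nuv : u != v by apply: contraTneq uv => ->; rewrite adj_irr.
have := set21 u v; have := set22 u v; rewrite E !inE.
by case/orP=> /eqP v_eq /orP[] /eqP u_eq; move: nuv; rewrite v_eq u_eq ?eqxx //= ?orbT; auto.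
Qed.

Section SetWeights.
Variables (R : realFieldType) (T : finType) (w : T -> T -> T -> R).
Hypotheses (w12 : forall x y z, w x y z = w y x z) (w23 : forall x y z, w x y z = w x z y).
Hypothesis wd : forall x y, w x x y = 0.

(** As [w] is symmetric, it does not matter which enumeration of [A] is picked. *)
Definition set_weight (A : {set T}) : R :=
  if [pick e : T * T * T | uniq [:: e.1.1; e.1.2; e.2] && (A == [set e.1.1; e.1.2; e.2])]
  is Some e then w e.1.1 e.1.2 e.2 else 0.

Lemma set_weightE u v x : set_weight [set u; v; x] = w u v x.
Proof.
have mems a b c : [set a; b; c] =i [:: a; b; c].
  by move=> z; rewrite !inE orbA.
rewrite /set_weight; case: pickP => [[[p q] r] /= /andP[upqr /eqP E]|no].
  have pE : [:: p; q; r] =i [:: u; v; x] by move=> z; rewrite -!mems E.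
  have uuvx : uniq [:: u; v; x] by rewrite -(eq_uniq _ pE).
  have e1 : w x v u = w u v x by rewrite w12 w23 w12.
  have e2 : w v x u = w u v x by rewrite w23 w12.
  have e3 : w x u v = w u v x by rewrite w12 w23.
  have e4 : w u x v = w u v x by rewrite w23.
  have e5 : w v u x = w u v x by rewrite w12.
  have := pE p; have := pE q; have := pE r; move: upqr uuvx.
  rewrite /= !inE !eqxx !orbT /= !andbT !negb_or -!andbA => /and3P[pq pr qr] _.
  move=> /esym /or3P[] /eqP rE /esym /or3P[] /eqP qE /esym /or3P[] /eqP pE';
    move: pq pr qr; by rewrite rE qE pE' ?eqxx.
have := no (u, v, x); rewrite /= eqxx andbT !inE andbT => /negbT.
rewrite negb_and !negbK => /orP[/orP[]|] /eqP ->; first by rewrite wd.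
  by rewrite w23 wd.
by rewrite w12 w23 wd.
Qed.

End SetWeights.

Lemma few_missing_pairs (T : finType) (G : sgraph T) :
  (4 <= #|T|)%N -> ('C(#|T|, 2) - (#|T| - 4) <= #|edges G|)%N ->
  (missing (fun x y => (x != y) && ~~ G x y) [set: T] + 8 <= 2 * #|T|)%N.
Proof.
move=> T4 many.
have C2 : ('C(#|T|, 2) * 2 = #|T| * #|T|.-1)%N.
  by have := bin_ffact #|T| 2; rewrite ffactnS ffactn1.
have : (missing (fun x y => (x != y) && ~~ G x y) [set: T] + 2 * #|edges G|
    = #|T| * #|T|.-1)%N.
  rewrite card_edges /missing /degree (eq_bigl predT) => [|x]; last by rewrite inE.
  rewrite -big_split /= -sum_nat_const; apply: eq_bigr => x _.
  rewrite (eq_bigl predT) => [|y]; last by rewrite inE.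
  rewrite -big_split /= (bigD1 x) //= eqxx adj_irr add0n -(cardC1 x) -sum1_card.
  by apply: eq_bigr => y; rewrite eq_sym => ->; case: (G x y).
by move: many C2 T4; nia.
Qed.

Lemma triangle_decomposition_of_few_missing (R : realType) (T : finType) (G : sgraph T) :
  (7 <= #|T|)%N -> ('C(#|T|, 2) - (#|T| - 4) <= #|edges G|)%N ->
  exists omega : {set T} -> R, fractional_triangle_decomposition G omega.
Proof.
move=> n_ge7 many_edges; pose h x y := (x != y) && ~~ G x y.
have few : (missing h [set: T] + 8 <= 2 * #|T|)%N.
  by apply: few_missing_pairs => //; lia.
have hR : total_weight [set: T] (fun x y => (h x y)%:R : R) <= 2 * (#|[set: T]|%:R - 4).
  by move: few; rewrite cardsT total_weight_missing -(ler_nat R) natrD natrM; lra.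
have h_weighting : weighting (fun x y => (h x y)%:R : R).
  split=> [x y|x y|x]; first by rewrite ler0n lern1 leq_b1.
    by rewrite /h eq_sym adj_sym.
  by rewrite /h eqxx.
have T7 : (7 <= #|[set: T]|)%N by rewrite cardsT.
have [w [w0 w12 w23 wd ws]] := all_resilient T7 h_weighting hR.
have wsum x y : x != y -> \sum_z w x y z = (G x y)%:R.
  move=> xy; rewrite ws // /demand !inE !mul1r /h xy /=.
  by case: (G x y); rewrite /= ?subr0 ?subrr.
have wE := set_weightE w12 w23 wd.
have G_neq x y : G x y -> x != y by apply: contraTneq => ->; rewrite adj_irr.
have wG x y z : w x y z != 0 -> G x y.
  move=> wxyz; have xy : x != y by apply: contraNneq wxyz => ->; rewrite wd.
  apply: contraNT wxyz => nG; have := wsum x y xy; rewrite (negPf nG).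
  by move/eqP; rewrite psumr_eq0 // => /allP /(_ z (mem_index_enum _)).
have edge_sum u v : G u v -> edge_weight (set_weight w) u v = 1.
  move=> Guv; rewrite /edge_weight (eq_bigr (w u v)); first by rewrite wsum ?G_neq ?Guv.
  by move=> x _; rewrite wE.
exists (set_weight w); split=> //; split=> [A||u v /edge_sum ->] //.
- rewrite inE => /existsP[u /existsP[v /existsP[x /and4P[Guv _ _ /eqP ->]]]].
  rewrite wE w0 /=; apply: (@le_trans _ _ (\sum_z w u v z)); last by rewrite wsum ?G_neq ?Guv.
  by rewrite (bigD1 x) //= lerDl sumr_ge0.
move=> A; apply: contraNeq; rewrite /set_weight.
case: pickP => [[[p q] r] /= /andP[_ /eqP ->] wpqr|_]; last by rewrite eqxx.
rewrite inE; apply/existsP; exists p; apply/existsP; exists q; apply/existsP; exists r.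
have -> : G p q by apply: wG wpqr.
have -> : G q r by apply: (wG q r p); rewrite w23 w12.
have -> : G p r by apply: (wG p r q); rewrite w23.
by rewrite eqxx.
Qed.

Local Close Scope ring_scope.

Theorem theorem1p1 (R : realType) (T : finType) (G : sgraph T) (n : nat)
    (card_V : #|T| = n) (n_ge7 : 7 <= n)
    (many_edges : 'C(n, 2) - (n - 4) <= #|edges G|) :
  exists omega : {set T} -> R, fractional_triangle_decomposition G omega.
Proof. by subst n; apply: triangle_decomposition_of_few_missing. Qed.
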